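(* Let $d$ and $k$ be fixed positive integers. There is a semi-online algorithm that, for any $\epsilon>0$, computes a feasible solution for the Maximum Independent Set problem in a narrow $d$-dimensional Line of Sight network with parameters $n$, $k$ and range parameter $\omega$ (presented with its embedding in $\mathbb{Z}^d_{n,k}$) that is a $(1+\epsilon)$-approximation of the optimum, in time $$O\left(\left(1+\frac{1}{\epsilon}\right) n\,k^{d-1}\,\bigl(k^{(d-1)/\omega}\,\omega\bigr)^{k^{d-1}}\right).$$
   Context: For positive integers $d,k,n$: $\mathbb{Z}^d_n=\{1,\dots,n\}^d$, and $\mathbb{Z}^d_{n,k}$ denotes a ''narrow'' cube $\{1,\dots,n\}\times\{1,\dots,x_1\}\times\cdots\times\{1,\dots,x_{d-1}\}$ where the $x_i$ are positive integers bounded by $k$, a positive integer constant independent of $n$. Two distinct points share a line of sight if their coordinates differ in exactly one place. A weighted graph is a triple $G=(V,E,w)$ with $w$ assigning a positive weight to each vertex (unweighted means $w\equiv 1$). $G$ is a narrow $d$-dimensional Line of Sight (LoS) network with range parameter $\omega$ (a positive integer) if there is an embedding (injective map) $f_G:V\to\mathbb{Z}^d_n$ with $f_G(V)\subseteq\mathbb{Z}^d_{n,k}$ such that $\{u,v\}\in E$ if and only if $f_G(u)$ and $f_G(v)$ share a line of sight and their Manhattan distance is less than $\omega$. For $j\in\{1,\dots,n\}$ the $j$-th column of $G$ is the set of vertices whose first embedding coordinate is $j$. The Maximum Independent Set (MIS) problem asks for an independent set maximizing the sum of the weights of its elements. A $(1+\epsilon)$-approximation is an independent set whose total weight is at least $1/(1+\epsilon)$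 times the optimum. An algorithm is semi-online if the columns of the input are revealed in order and the algorithm is only allowed to observe the input up to a certain look-ahead distance (number of columns ahead of the current position); here the look-ahead distance depends on $\epsilon$ (and on $k,d,\omega$) but not on $n$. *)

(* Defs.v *)
From HB Require Import structures.
From mathcomp Require Import all_boot all_order all_algebra.
From mathcomp Require Import all_classical all_reals all_analysis.

Set Implicit Arguments.
Unset Strict Implicit.
Unset Printing Implicit Defensive.

Import Order.TTheory GRing.Theory Num.Theory.

Local Open Scope ring_scope.

(** * Weighted graphs and independent sets *)

Record wgraph (R : realType) := WGraph {
  vertex :> finType;
  edge : rel vertex;
  weight : vertex -> R;
  edge_sym : symmetric edge;
  edge_irr : irreflexive edge;
  weight_gt0 : forall v, 0 < weight v
}.

Section IndependentSets.
Variables (R : realType) (G : wgraph R).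

Definition independent (S : {set G}) : bool :=
  [forall u in S, forall v in S, ~~ edge u v].

Definition set_weight (S : {set G}) : R := \sum_(v in S) weight v.

(* Weights are positive and the empty set is independent, so the default
   value 0 of the maximum is harmless. *)
Definition mis_weight : R :=
  \big[Num.max/0]_(S : {set G} | independent S) set_weight S.

Definition approx_mis (eps : R) (S : {set G}) : Prop :=
  independent S /\ (1 + eps)^-1 * mis_weight <= set_weight S.

End IndependentSets.

(** * Narrow line of sight networks *)

(* [box [:: b1; ..; bd]] is {1..b1} x ... x {1..bd}. *)
Definition box (b : seq nat) (p : seq nat) : bool :=
  all2 (fun c m => (0 < c <= m)%N) p b.

Definition line_of_sight d (p q : d.-tuple nat) : bool :=
  #|[set i : 'I_d | tnth p i != tnth q i]| == 1%N.

Definition manhattan d (p q : d.-tuple nat) : nat :=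
  (\sum_(i < d) `|(tnth p i)%:Z - (tnth q i)%:Z|)%N.

Definition narrow_los (R : realType) (d n k omega : nat) (G : wgraph R)
    (f : G -> d.-tuple nat) : Prop :=
  [/\ injective f,
      forall v, box (nseq d n) (f v),
      exists x : d.-1.-tuple nat,
        all (fun m => (0 < m <= k)%N) x /\ forall v, box (n :: x) (f v)
    & forall u v, edge u v =
        line_of_sight (f u) (f v) && (manhattan (f u) (f v) < omega)%N].

(** * Semi-online algorithms

    Unit-cost random access machines, presented as while-programs over
    finitely many arrays, indexed by natural numbers, of natural numbers and of
    reals.  The arithmetic is limited to addition, (truncated) subtraction and
    comparison.  A program is pure syntax: it contains no real constant other
    than 0 and 1, and it is independent of the input graph. *)

Inductive nexp :=
| NConst of nat
| NGet of nat & nexp                     (* array name, index *)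
| NAdd of nexp & nexp
| NSub of nexp & nexp.

Inductive rexp :=
| RZero
| ROne
| RGet of nat & nexp
| RAdd of rexp & rexp
| RSub of rexp & rexp.

Inductive bexp :=
| BLeN of nexp & nexp
| BLeR of rexp & rexp
| BNot of bexp
| BAnd of bexp & bexp.

Inductive cmd :=
| Skip
| NSet of nat & nexp & nexp              (* array name, index, value *)
| RSet of nat & nexp & rexp
| Query of nat & nexp & nexp & seq nexp  (* target array and index; column;
                                            remaining coordinates *)
| HasColumn of nat & nexp & nexp         (* target array and index; column *)
| Select of seq nexp                     (* all coordinates but the first *)
| Advance
| Seq of cmd & cmd
| If of bexp & cmd & cmd
| While of bexp & cmd.

(* Evaluating an expression costs one unit per node. *)
Fixpoint ncost (e : nexp) : nat :=
  match e with
  | NConst _ => 1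
  | NGet _ e1 => (ncost e1).+1
  | NAdd e1 e2 | NSub e1 e2 => (ncost e1 + ncost e2).+1
  end.

Fixpoint rcost (e : rexp) : nat :=
  match e with
  | RZero | ROne => 1
  | RGet _ e1 => (ncost e1).+1
  | RAdd e1 e2 | RSub e1 e2 => (rcost e1 + rcost e2).+1
  end.

Fixpoint bcost (e : bexp) : nat :=
  match e with
  | BLeN e1 e2 => (ncost e1 + ncost e2).+1
  | BLeR e1 e2 => (rcost e1 + rcost e2).+1
  | BNot e1 => (bcost e1).+1
  | BAnd e1 e2 => (bcost e1 + bcost e2).+1
  end.

Definition scost (es : seq nexp) : nat := (\sum_(e <- es) ncost e)%N.

(* [pos] is the current column; [out] lists the points selected so far.  The
   output is irrevocable, and only points of the current column can be added. *)
Record state (R : realType) := State {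
  nmem : nat -> nat -> nat;
  rmem : nat -> nat -> R;
  pos : nat;
  out : seq (seq nat)
}.

Definition upd (T : Type) (m : nat -> nat -> T) (a i : nat) (v : T) :
    nat -> nat -> T :=
  fun b j => if (b == a) && (j == i) then v else m b j.

Section Semantics.
Variable R : realType.
Implicit Types s : state R.

Fixpoint neval s (e : nexp) : nat :=
  match e with
  | NConst c => c
  | NGet a e1 => nmem s a (neval s e1)
  | NAdd e1 e2 => (neval s e1 + neval s e2)%N
  | NSub e1 e2 => (neval s e1 - neval s e2)%N
  end.

Fixpoint reval s (e : rexp) : R :=
  match e with
  | RZero => 0
  | ROne => 1
  | RGet a e1 => rmem s a (neval s e1)
  | RAdd e1 e2 => reval s e1 + reval s e2
  | RSub e1 e2 => reval s e1 - reval s e2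
  end.

Fixpoint beval s (e : bexp) : bool :=
  match e with
  | BLeN e1 e2 => (neval s e1 <= neval s e2)%N
  | BLeR e1 e2 => reval s e1 <= reval s e2
  | BNot e1 => ~~ beval s e1
  | BAnd e1 e2 => beval s e1 && beval s e2
  end.

Definition set_n s a i v := State (upd (nmem s) a i v) (rmem s) (pos s) (out s).
Definition set_r s a i v := State (nmem s) (upd (rmem s) a i v) (pos s) (out s).
Definition set_pos s j := State (nmem s) (rmem s) j (out s).
Definition add_out s p := State (nmem s) (rmem s) (pos s) (p :: out s).

(* [exec n L inp c s t s']: on an input with [n] columns and cell contents
   [inp], and with look-ahead distance [L], the command [c] takes [s] to [s'] in
   time [t].  The input, including whether it has ended, is only reachable
   through [Query] and [HasColumn], which are stuck on columns beyond
   [pos + L]: the existence of a derivation entails both termination and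
   respect of the look-ahead distance. *)
Inductive exec (n L : nat) (inp : seq nat -> R) :
    cmd -> state R -> nat -> state R -> Prop :=
| ESkip s :
    exec n L inp Skip s 1 s
| ENSet s a i e :
    exec n L inp (NSet a i e) s (ncost i + ncost e).+1
         (set_n s a (neval s i) (neval s e))
| ERSet s a i e :
    exec n L inp (RSet a i e) s (ncost i + rcost e).+1
         (set_r s a (neval s i) (reval s e))
| EQuery s a i j es of (neval s j <= pos s + L)%N :
    exec n L inp (Query a i j es) s (ncost i + ncost j + scost es).+1
         (set_r s a (neval s i) (inp (neval s j :: map (neval s) es)))
| EHasColumn s a i j of (neval s j <= pos s + L)%N :
    exec n L inp (HasColumn a i j) s (ncost i + ncost j).+1
         (set_n s a (neval s i) (0 < neval s j <= n)%N)
| ESelect s es :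
    exec n L inp (Select es) s (scost es).+1
         (add_out s (pos s :: map (neval s) es))
| EAdvance s :
    exec n L inp Advance s 1 (set_pos s (pos s).+1)
| ESeq c1 c2 s1 s2 s3 t1 t2 of
    exec n L inp c1 s1 t1 s2 & exec n L inp c2 s2 t2 s3 :
    exec n L inp (Seq c1 c2) s1 (t1 + t2).+1 s3
| EIfTrue b c1 c2 s s' t of beval s b & exec n L inp c1 s t s' :
    exec n L inp (If b c1 c2) s (bcost b + t).+1 s'
| EIfFalse b c1 c2 s s' t of ~~ beval s b & exec n L inp c2 s t s' :
    exec n L inp (If b c1 c2) s (bcost b + t).+1 s'
| EWhileTrue b c s1 s2 s3 t1 t2 of
    beval s1 b & exec n L inp c s1 t1 s2 & exec n L inp (While b c) s2 t2 s3 :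
    exec n L inp (While b c) s1 (bcost b + t1 + t2).+1 s3
| EWhileFalse b c s of ~~ beval s b :
    exec n L inp (While b c) s (bcost b).+1 s.

Lemma exec_det n L inp c s t1 s1 t2 s2 :
  exec n L inp c s t1 s1 -> exec n L inp c s t2 s2 -> t1 = t2 /\ s1 = s2.
Proof.
move=> H1; elim: H1 t2 s2 => {c s t1 s1};
  intros; match goal with H : exec _ _ _ _ _ ?t ?s |- _ = ?t /\ _ = ?s =>
    inversion H; subst; clear H end => //;
  repeat match goal with
  | hb : is_true ?b, hn : is_true (~~ ?b) |- _ => by rewrite hb in hn
  | IH : (forall t s, exec _ _ _ ?c ?x t s -> _), H : exec _ _ _ ?c ?x _ _ |- _ =>
    have [? ?] := IH _ _ H; subst; clear IH
  end => //.
Qed.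

(* All memory is zero except for the parameters eps and omega; the number of
   columns is not given to the program. *)
Definition init (eps : R) (omega : nat) : state R :=
  State (upd (fun _ _ => 0%N) 0 0 omega) (upd (fun _ _ => 0) 0 0 eps) 1 [::].

End Semantics.

(* The input of the program: the weight of the vertex embedded at [p], and 0 if
   there is none.  As the embedding is injective the sum has at most one term. *)
Definition cell_weight (R : realType) (d : nat) (G : wgraph R)
    (f : G -> d.-tuple nat) (p : seq nat) : R :=
  \sum_(v : G | val (f v) == p) weight v.

(* Main.v *)
(* The K = k^(d-1) rows of the network are cut into blocks of omega columns, so an
   independent set has at most one vertex per row and block, and blocks separated
   by an empty block do not interact.  Let U(b) be the largest weight in block b.
   One vertex of maximal weight in every other block is an independent set, hence
   the sum of all U(b) is at most 2 OPT, while the optimal set has weight at most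
   K U(b) in block b.

   Let m = ceil(1/eps) and M = 2 K (m + 1).  From the current block B, the
   algorithm picks among the blocks B + M, ..., B + 2 M - 1 the one minimising U,
   leaves it empty, and solves the columns before it exactly; it then continues
   after the empty block.  The windows of candidates are disjoint, so the empty
   blocks cost at most K (1/M) 2 OPT = OPT / (m + 1), and m eps >= 1 gives the ratio.

   The exact solution is a cell-by-cell dynamic program over omega^K states, a
   state recording for each row in how many further columns it is blocked: a
   backward pass tabulates the values, and a forward pass replays the decisions.
   The look-ahead is 2 M omega columns, and every column costs O(omega^K). *)

Require Import Defs.
From HB Require Import structures.
From mathcomp Require Import all_boot all_order all_algebra.
From mathcomp Require Import all_classical all_reals all_analysis.
From mathcomp Require Import zify ring lra.

Import Order.TTheory GRing.Theory Num.Theory.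
Local Open Scope ring_scope.

(** The obstacle is uniformity: one program, fixed by [d] and [k], serves every [eps] and [omega],
    using only addition, subtraction and comparison, and is not told [n]. What depends on the rows
    alone (coordinates, adjacency, distances) is compiled into the code, with loops over rows
    unrolled. What depends on [omega] (its powers, the digits of all states) is tabulated beforehand
    by additions, so that updating a state adds or subtracts tabulated powers. The end of the input
    is discovered column by column. This matters for the time: M omega may far exceed n, so the
    table of the last segment must cover existing columns only. A search reads M omega columns
    without touching the table; every segment but the last has at least that many columns and pays
    for its own search. The last search and the computation of m are what put the factor 1 + 1/eps
    into the bound. Optimality of a segment is proved without naming an optimal set for it: the part
    of OPT inside is bounded by the tabulated value, and the replay never decreases selected weight
    plus remaining value. *)

(** * Base-[b] digits by addition and subtraction *)

Section Digits.
Variable b : nat.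
Hypothesis b_gt0 : (0 < b)%N.
Local Open Scope nat_scope.

Definition dig (i x : nat) : nat := x %/ b ^ i %% b.
Definition dec (i x : nat) : nat := if 0 < dig i x then x - b ^ i else x.
(** Raises a zero digit to [b - 1]; the increment is written with two powers of [b], which the
    program holds in memory. *)
Definition put (i x : nat) : nat := x + (b ^ i.+1 - b ^ i).

Lemma dig_lt i x : dig i x < b.
Proof. exact: ltn_pmod. Qed.

Lemma dig0 i : dig i 0 = 0.
Proof. by rewrite /dig div0n mod0n. Qed.

Lemma dig_decomp i x :
  x = x %% b ^ i + b ^ i * (dig i x + b * (x %/ b ^ i %/ b)).
Proof.
have e := divn_eq (x %/ b ^ i) b.
rewrite {1}(divn_eq x (b ^ i)) addnC mulnC; congr (_ + _ * _).
by rewrite {1}e addnC mulnC.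
Qed.

Lemma dig_digit i a r q : a < b ^ i -> r < b ->
  dig i (a + b ^ i * (r + b * q)) = r.
Proof.
move=> ha hr; rewrite /dig addnC mulnC divnMDl ?expn_gt0 ?b_gt0 //.
by rewrite (divn_small ha) addn0 addnC mulnC modnMDl modn_small.
Qed.

(** For [i' < i] the part above [a] is a multiple of [b ^ i'.+1], invisible to digit [i']; for
    [i' > i] dividing by [b ^ i.+1] already forgets digit [i]. *)
Lemma dig_other i i' a r r' q : i != i' -> a < b ^ i -> r < b -> r' < b ->
  dig i' (a + b ^ i * (r + b * q)) = dig i' (a + b ^ i * (r' + b * q)).
Proof.
move=> ne ha hr hr'; rewrite /dig.
have [lt|le] := ltnP i' i.
  have -> : i = i' + (i - i'.+1).+1 by lia.
  rewrite expnD expnS -!mulnA.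
  set y := b ^ _ * (r + _); set y' := b ^ _ * (r' + _).
  rewrite ![a + _]addnC ![b ^ i' * _]mulnC !divnMDl ?expn_gt0 ?b_gt0 //.
  by rewrite ![b * _]mulnC !modnMDl.
have -> : i' = i.+1 + (i' - i.+1) by lia.
rewrite expnD !divnMA.
suff H s : s < b -> (a + b ^ i * (s + b * q)) %/ b ^ i.+1 = q.
  by rewrite !H.
move=> hs; rewrite mulnDr mulnA -expnSr addnA addnC mulnC divnMDl ?expn_gt0 ?b_gt0 //.
rewrite divn_small ?addn0 // expnS.
move: ha hs; move: (b ^ i) => B; clear; nia.
Qed.

Lemma dig_dec i i' x : dig i' (dec i x) = if i' == i then (dig i x).-1 else dig i' x.
Proof.
rewrite /dec; case: ifPn => [pos|]; last first.
  by rewrite -eqn0Ngt => /eqP z; case: eqP => // ->; rewrite z.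
have ha : x %% b ^ i < b ^ i by rewrite ltn_pmod ?expn_gt0 ?b_gt0.
have e : x - b ^ i = x %% b ^ i + b ^ i * ((dig i x).-1 + b * (x %/ b ^ i %/ b)).
  rewrite {1}(dig_decomp i x); case: (dig i x) pos => // r _.
  by rewrite addSn [b ^ i * _.+1]mulnS addnCA addKn.
have := dig_lt i x => hd; rewrite e.
case: eqP => [->|/eqP ne]; first by rewrite dig_digit //; lia.
rewrite [in RHS](dig_decomp i x); apply: dig_other; rewrite // 1?eq_sym //; lia.
Qed.

Lemma put_decomp i x : dig i x = 0 ->
  put i x = x %% b ^ i + b ^ i * (b.-1 + b * (x %/ b ^ i %/ b)).
Proof.
move=> z; rewrite /put {1}(dig_decomp i x) z expnS; move: (x %% _) (_ %/ b) => a q.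
have -> : b * b ^ i - b ^ i = b ^ i * b.-1 by rewrite -subn1 mulnBr muln1 mulnC.
by rewrite add0n mulnDr -addnA; congr (_ + _); rewrite addnC.
Qed.

Lemma dig_put i i' x : dig i x = 0 ->
  dig i' (put i x) = if i' == i then b.-1 else dig i' x.
Proof.
move=> z.
have ha : x %% b ^ i < b ^ i by rewrite ltn_pmod ?expn_gt0 ?b_gt0.
have e : put i x = x %% b ^ i + b ^ i * (b.-1 + b * (x %/ b ^ i %/ b)).
  exact: put_decomp.
have hd : b.-1 < b by lia.
rewrite e.
case: eqP => [->|/eqP ne]; first by rewrite dig_digit.
rewrite [in RHS](dig_decomp i x); apply: dig_other; rewrite // 1?eq_sym // z; lia.
Qed.

Lemma dec_lt i x N : x < N -> dec i x < N.
Proof. by rewrite /dec; case: ifP => // _; apply: leq_ltn_trans; exact: leq_subr. Qed.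

Lemma put_lt i x K : i < K -> dig i x = 0 -> x < b ^ K -> put i x < b ^ K.
Proof.
move=> iK z xK.
have e : put i x = x %% b ^ i + b ^ i * (b.-1 + b * (x %/ b ^ i %/ b)).
  exact: put_decomp.
have ha : x %% b ^ i < b ^ i by rewrite ltn_pmod ?expn_gt0 ?b_gt0.
have hK : b ^ K = b ^ i.+1 * b ^ (K - i.+1) by rewrite -expnD; congr (_ ^ _); lia.
have hq : x %/ b ^ i %/ b < b ^ (K - i.+1).
  by rewrite -divnMA -expnSr ltn_divLR ?expn_gt0 ?b_gt0 // mulnC -hK.
rewrite e hK expnS; move: (b ^ (K - _)) hq => C hq.
have hC : b * b ^ i * (x %/ b ^ i %/ b).+1 <= b * b ^ i * C by rewrite leq_mul2l hq orbT.
apply: leq_trans hC; rewrite mulnS mulnDr mulnA [b ^ i * b]mulnC.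
have -> : b ^ i * b.-1 = b * b ^ i - b ^ i by rewrite -subn1 mulnBr muln1 mulnC.
have : b ^ i <= b * b ^ i by rewrite leq_pmull.
lia.
Qed.

(* The recurrence by which the digits are tabulated with additions only. *)
Lemma dig_rec i x : dig i x =
  if x < b ^ i then 0 else if (dig i (x - b ^ i)).+1 < b then (dig i (x - b ^ i)).+1 else 0.
Proof.
case: ltnP => [lt|le]; first by rewrite /dig divn_small // mod0n.
rewrite /dig -{1}(subnK le).
have h : 0 < b ^ i by rewrite expn_gt0 b_gt0.
rewrite divnDr ?dvdnn // divnn h addn1.
set y := _ %/ _; rewrite -addn1 -modnDml.
have h2 := ltn_pmod y b_gt0; case: (ltnP (y %% b).+1) => h1; first by rewrite addn1 modn_small.
have -> : y %% b + 1 = b by lia.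
exact: modnn.
Qed.

End Digits.
(** * Dynamic programming over the blocked rows *)

Section Cells.
Variables (K ec : nat).
Hypothesis K_gt0 : (0 < K)%N.

(* The cells of the columns before [ec] are numbered from the last one: the
   cell with number [q] is preceded in the processing order by those with
   larger numbers. *)
Definition crow q := (K.-1 - q %% K)%N.
Definition ccol q := (ec.-1 - q %/ K)%N.

(** The horizon of row [i] once the cells numbered [q] and above are processed: its columns below
    this number are done. Rows go in increasing order within a column, so the horizon is one larger
    for rows already passed. *)
Definition ndone q i := (ec - (q + i) %/ K)%N.

Lemma crow_lt q : (crow q < K)%N.
Proof. by rewrite (leq_ltn_trans (leq_subr _ _)) // prednK. Qed.

Lemma ndone_row q : (q %/ K < ec)%N -> ndone q.+1 (crow q) = ccol q.
Proof.
move=> h; rewrite /ndone /ccol /crow.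
have e : (q.+1 + (K.-1 - q %% K) = (q %/ K).+1 * K)%N.
  by have := divn_eq q K; have := ltn_pmod q K_gt0; lia.
by rewrite e mulnK //; case: ec h.
Qed.

Lemma ndone_step q i : (q %/ K < ec)%N -> (i < K)%N ->
  ndone q i = if i == crow q then (ndone q.+1 i).+1 else ndone q.+1 i.
Proof.
move=> h iK; rewrite /ndone addSn divnS //.
have lt := ltn_pmod q K_gt0.
(* Modulo [K] this is [q %% K + i + 1], which lies between 1 and [2 * K - 1], so the only multiple
   it can meet is [K] itself. *)
have -> : (K %| (q + i).+1)%N = (i == crow q).
  have e : ((q + i).+1 = (q %/ K) * K + (q %% K + i).+1)%N by rewrite {1}(divn_eq q K); lia.
  rewrite e dvdn_addr ?dvdn_mull // /crow.
  apply/idP/eqP => [/dvdnP[[|[|r]] hr]|->]; [lia|lia|nia|].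
  by have -> : (q %% K + (K.-1 - q %% K)).+1 = K by lia.
case: eqP => [e|_]; last by rewrite add0n.
have : ((q + i) %/ K = q %/ K)%N.
  rewrite {1}(divn_eq q K) -addnA divnMDl // [((q %% K + i) %/ K)%N]divn_small ?addn0 //.
  by rewrite e /crow; move: lt K_gt0; clear; move: (q %% _)%N => r; lia.
by move->; move: h; clear; move: (q %/ K)%N; lia.
Qed.

Lemma ndone_lt q i : (q %/ K < ec)%N -> (i < crow q)%N -> ndone q.+1 i = (ccol q).+1.
Proof.
move=> h iq; rewrite /ndone /ccol.
have -> : (q.+1 + i = (q %/ K) * K + (q %% K + i).+1)%N by rewrite {1}(divn_eq q K); lia.
rewrite divnMDl // [((_ %% _ + _).+1 %/ _)%N]divn_small ?addn0; last first.
  by move: iq (ltn_pmod q K_gt0); move: K_gt0; rewrite /crow; clear; move: (q %% _)%N => r; lia.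
by move: h; clear; move: (q %/ K)%N; lia.
Qed.

Lemma ndone_anti q i i' : (i <= i')%N -> (ndone q i' <= ndone q i)%N.
Proof. by move=> le; rewrite leq_sub2l // leq_div2r // leq_add2l. Qed.

Lemma ndone_le q i : (ndone q.+1 i <= ndone q i)%N.
Proof. by rewrite leq_sub2l // leq_div2r // leq_add2r. Qed.

Lemma ndone_mul c i : (i < K)%N -> ndone (c * K) i = (ec - c)%N.
Proof. by move=> iK; rewrite /ndone divnMDl // divn_small // addn0. Qed.

End Cells.

(** * How long a row stays blocked *)

Section Blocking.
Variables (omega : nat).
Hypothesis omega_gt0 : (0 < omega)%N.
Implicit Types A B : nat -> nat -> bool.

(* The number of further columns in which row [i] is blocked, once the columns
   before [e] have been processed. *)
Fixpoint rem A (i e : nat) : nat :=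
  if e is e'.+1 then if A e' i then omega.-1 else (rem A i e').-1 else 0.

(** The right side says that column [e + t] is too close to a selection. It holds for any [A],
    independent or not, because a new selection resets the counter to its largest value
    [omega.-1]. *)
Lemma remP A i e t : (t < rem A i e)%N <->
  exists j, [/\ (j < e)%N, A j i & (e - j + t < omega)%N].
Proof.
elim: e t => [|e IH] t /=; first by split=> // -[j []].
case: ifP => Ae; split.
- by exists e; split=> //; lia.
- by case=> j [? _ ?]; lia.
- move=> lt; have /IH[j [je Aj h]] : (t.+1 < rem A i e)%N by lia.
  by exists j; split=> //; lia.
- case=> j [je Aj h]; suff : (t.+1 < rem A i e)%N by lia.
  apply/IH; exists j; split=> //; last by lia.
  by move: je; rewrite ltnS leq_eqVlt => /orP[/eqP e1|//]; rewrite e1 Ae in Aj.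
Qed.

Lemma rem_lt A i e : (rem A i e < omega)%N.
Proof. by elim: e => [|e IH] //=; case: ifP => _; lia. Qed.

Lemma eq_rem A B i e : (forall j, (j < e)%N -> A j i = B j i) ->
  rem A i e = rem B i e.
Proof. by elim: e => //= e IH h; rewrite h // IH // => j je; rewrite h // ltnW. Qed.

Lemma rem_eq0 A i e : (forall j, A j i -> (j < e)%N -> (j + omega <= e)%N) -> rem A i e = 0%N.
Proof.
move=> h; apply/eqP; rewrite -leqn0 leqNgt; apply/negP => /remP[j [je Aj]].
by have := h j Aj je; lia.
Qed.

End Blocking.

(** * The dynamic program *)

Section DynamicProgram.
Context {R : realType} (K omega : nat) (cfl : rel nat) (w : nat -> nat -> R).
Hypotheses (K_gt0 : (0 < K)%N) (omega_gt0 : (0 < omega)%N).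
Hypothesis cfl_omega : forall i i', cfl i i' -> (1 < omega)%N.
Implicit Types (A B : nat -> nat -> bool) (V : nat -> R).
Local Notation rem := (rem omega).

(** Each conflicting pair is tested at its later cell in processing order, which is what a
    left-to-right pass can check. Positivity of the weight excludes cells holding no vertex. *)
Definition indep A : Prop := forall j i, A j i ->
  [/\ (i < K)%N, 0 < w j i,
      forall j', (j' < j)%N -> A j' i -> (omega <= j - j')%N
    & forall i', (i' < i)%N -> A j i' -> ~~ cfl i' i].

(* Digit [i] of a state [x] is the number of further columns in which row [i] is
   blocked, so it equals [omega.-1] exactly for the rows selected in the current
   column. *)
Definition free (i x : nat) (c : R) : bool :=
  [&& dig omega i x == 0%N, 0 < c &
    all (fun i' => ~~ (cfl i' i && (omega <= (dig omega i' x).+1)%N)) (iota 0 i)].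

(** In a free cell the digit is 0 and [dec] is the identity, so [V x] is the value of skipping and
    [step] is the maximum of both options. *)
Definition take_test i c V x : bool := free i x c && (V x <= c + V (put omega i x)).

Definition step i c V x : R :=
  if take_test i c V x then c + V (put omega i x) else V (dec omega i x).

Variable ec : nat.
Local Notation crow := (crow K).
Local Notation ccol := (ccol K ec).
Local Notation ndone := (ndone K ec).

Fixpoint value q x : R :=
  if q is q'.+1 then step (crow q') (w (ccol q') (crow q')) (value q') x else 0.

(** Each row is read at its own horizon, so that a column processed halfway is described as well. *)
Definition stq A q x := (x < omega ^ K)%N /\
  forall i, (i < K)%N -> dig omega i x = rem A i (ndone q i).

Lemma stq_dec A q x : (q %/ K < ec)%N -> stq A q.+1 x -> ~~ A (ccol q) (crow q) ->
  stq A q (dec omega (crow q) x).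
Proof.
move=> h [xW dx] nA; split=> [|i iK]; first exact: dec_lt.
rewrite dig_dec // ndone_step //; case: eqP => [->|_]; last exact: dx.
by rewrite dx ?crow_lt // ndone_row //= (negbTE nA).
Qed.

Lemma stq_put A q x : (q %/ K < ec)%N -> stq A q.+1 x -> A (ccol q) (crow q) ->
  dig omega (crow q) x = 0%N -> stq A q (put omega (crow q) x).
Proof.
move=> h [xW dx] hA d0; split=> [|i iK]; first exact: put_lt (crow_lt K K_gt0 _) _ _.
rewrite dig_put // ndone_step //; case: eqP => [->|_]; last exact: dx.
by rewrite ndone_row //= hA.
Qed.

(** Digits of rows before [crow q] already account for the current column, that of [crow q] only for
    the columns before it. The digit [omega.-1] reveals a selection in the current column; at
    [omega = 1] every digit has this value, but then [cfl_omega] leaves no conflict to test. *)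
Lemma freeP A q x c : (q %/ K < ec)%N -> stq A q.+1 x ->
  free (crow q) x c <->
  [/\ 0 < c,
      forall j', (j' < ccol q)%N -> A j' (crow q) -> (omega <= ccol q - j')%N
    & forall i', (i' < crow q)%N -> A (ccol q) i' -> ~~ cfl i' (crow q)].
Proof.
move=> h [xW dx].
have dr : dig omega (crow q) x = rem A (crow q) (ccol q).
  by rewrite dx ?crow_lt // ndone_row.
have di i' : (i' < crow q)%N -> dig omega i' x = rem A i' (ccol q).+1.
  by move=> lt; rewrite dx ?ndone_lt //; exact: ltn_trans lt (crow_lt K K_gt0 _).
split.
- case/and3P => /eqP d0 c0 /allP hall; split=> // [j' lt Aj|i' lt Ai].
    rewrite leqNgt; apply/negP => lt2.
    suff : (0 < rem A (crow q) (ccol q))%N by rewrite -dr d0.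
    by apply/(remP omega omega_gt0); exists j'; rewrite addn0.
  have := hall i'; rewrite mem_iota /= add0n => /(_ lt).
  rewrite di //= Ai; case: cfl => //=.
  by rewrite prednK ?leqnn.
- case=> c0 hr hi; apply/and3P; split=> //.
    rewrite dr; apply/eqP; apply: rem_eq0 => // j' Aj lt; have := hr j' lt Aj; lia.
  apply/allP => i'; rewrite mem_iota /= add0n => lt; rewrite di //=.
  apply/negP => /andP[ci]; case: ifPn => [Ai|_]; first by rewrite (negbTE (hi _ lt Ai)) in ci.
  by have := rem_lt omega omega_gt0 A i' (ccol q); have := cfl_omega _ _ ci; lia.
Qed.

Lemma step_dec i c V x : V (dec omega i x) <= step i c V x.
Proof.
rewrite /step /take_test; case: ifP => // /andP[/and3P[/eqP d0 _ _]].
by rewrite /dec d0.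
Qed.

Lemma step_put i c V x : free i x c -> c + V (put omega i x) <= step i c V x.
Proof.
move=> fr; rewrite /step /take_test fr /=; case: ifPn => //; rewrite -ltNge => /ltW.
by rewrite /dec; case/and3P: fr => /eqP -> _ _.
Qed.

Fixpoint restw A q : R :=
  if q is q'.+1 then (if A (ccol q') (crow q') then w (ccol q') (crow q') else 0) + restw A q'
  else 0.

(** The induction follows the decisions of [B]: [step] is at least the value of either option, so
    whichever one [B] takes keeps the bound. That the value is attained is shown by the forward
    pass. *)
Lemma val_upper B q x : indep B -> (q <= ec * K)%N -> stq B q x -> restw B q <= value q x.
Proof.
move=> iB; elim: q x => [//|q IH] x le st.
have h : (q %/ K < ec)%N by rewrite ltn_divLR.
have {}IH := IH _ (ltnW le).
cbn [restw value]; case: ifPn => hB; last first.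
  by rewrite add0r; apply: le_trans (step_dec _ _ _ _); apply: IH; exact: stq_dec.
have [_ c0 h1 h2] := iB _ _ hB.
have fr : free (crow q) x (w (ccol q) (crow q)) by apply/(freeP B).
apply: le_trans (step_put _ _ _ _ fr); rewrite lerD2l; apply: IH.
by apply: stq_put => //; case/and3P: fr => /eqP.
Qed.

Definition colw A j : R := \sum_(0 <= i < K) if A j i then w j i else 0.

Definition wt A a b : R := \sum_(a <= j < b) colw A j.

Lemma restw_row A c r : (r <= K)%N ->
  restw A (c * K + r) = restw A (c * K) +
    \sum_(K - r <= i < K) (if A (ec.-1 - c)%N i then w (ec.-1 - c)%N i else 0).
Proof.
elim: r => [|r IH] le; first by rewrite addn0 subn0 big_geq // addr0.
rewrite addnS; cbn [restw]; rewrite IH 1?ltnW //.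
have -> : crow (c * K + r) = (K - r.+1)%N by rewrite /crow modnMDl modn_small //; lia.
have -> : ccol (c * K + r) = (ec.-1 - c)%N.
  by rewrite /ccol divnMDl // divn_small // addn0.
rewrite addrCA; congr (_ + _); rewrite [in RHS]big_ltn; last by lia.
by congr (_ + _); have -> : (K - r = (K - r.+1).+1)%N by lia.
Qed.

Lemma restw_wt A c : (c <= ec)%N -> restw A (c * K) = wt A (ec - c) ec.
Proof.
elim: c => [|c IH] le; first by rewrite /wt subn0 big_geq.
rewrite mulSn addnC restw_row // IH 1?ltnW // subnn addrC /wt.
rewrite [RHS]big_ltn; last by lia.
have -> : (ec - c.+1 = ec.-1 - c)%N by lia.
by have -> : (ec - c = (ec.-1 - c).+1)%N by lia.
Qed.

Definition add_cell A j i : nat -> nat -> bool :=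
  fun j' i' => A j' i' || ((j' == j) && (i' == i)).

(** The new cell is last in processing order: [free] covers its conflicts with older cells, and no
    older cell has it among its predecessors. *)
Lemma indep_add A q x c : (q %/ K < ec)%N -> indep A ->
  (forall j i, A j i -> (j < ndone q.+1 i)%N) -> stq A q.+1 x ->
  free (crow q) x c -> c = w (ccol q) (crow q) -> indep (add_cell A (ccol q) (crow q)).
Proof.
move=> h iA lA st /(freeP A _ _ _ h st)[c0 hr hc] ec0.
have lr := ndone_row K ec K_gt0 q h.
move=> j i; rewrite /add_cell => /orP[Aj|/andP[/eqP-> /eqP->]]; last first.
  split=> [|||]; first exact: crow_lt.
  - by rewrite -ec0.
  - by move=> j' lt /orP[|/andP[/eqP e]]; [exact: hr|rewrite e ltnn in lt].
  - by move=> i' lt /orP[|/andP[_ /eqP e]]; [exact: hc|rewrite e ltnn in lt].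
have [iK w0 h1 h2] := iA _ _ Aj; split=> // [j' lt|i' lt] /orP[|/andP[/eqP ej /eqP ei]].
- exact: h1.
- by subst; have := lA _ _ Aj; rewrite lr ltnNge ltnW.
- exact: h2.
- by subst; have := lA _ _ Aj; rewrite ltnNge -{1}lr ndone_anti // ltnW.
Qed.

Lemma wt_add A j i a b : ~~ A j i -> (a <= j < b)%N -> (i < K)%N ->
  wt (add_cell A j i) a b = wt A a b + w j i.
Proof.
move=> nA jab iK.
have -> : w j i = \sum_(a <= j' < b) \sum_(0 <= i' < K)
    if (j' == j) && (i' == i) then w j i else 0.
  have E j' : \sum_(0 <= i' < K) (if (j' == j) && (i' == i) then w j i else 0)
      = if j' == j then w j i else 0.
    case: (j' == j) => /=; last by rewrite big1.
    by rewrite -big_mkcond /= big_nat1_eq iK.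
  under eq_bigr do rewrite E.
  by rewrite -big_mkcond /= big_nat1_eq jab.
rewrite /wt -big_split /=; apply: eq_bigr => j' _.
rewrite /colw -big_split /=; apply: eq_bigr => i' _.
rewrite /add_cell; case: (boolP (_ && _)) => [/andP[/eqP-> /eqP->]|_].
  by rewrite orbT (negbTE nA) add0r.
by rewrite orbF addr0.
Qed.

End DynamicProgram.
(** * Block maxima *)

Section BlockMaxima.
Context {R : realType} (K omega : nat) (cfl : rel nat) (w : nat -> nat -> R).
Hypothesis omega_gt0 : (0 < omega)%N.
Hypothesis w_ge0 : forall j i, 0 <= w j i.
Implicit Types (A B P : nat -> nat -> bool).

Lemma ler_sum_term (F : nat -> R) a j b : (a <= j < b)%N -> (forall i, 0 <= F i) ->
  F j <= \sum_(a <= i < b) F i.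
Proof.
move=> /andP[aj jb] F0.
rewrite (big_cat_nat aj (ltnW jb)) /= [X in _ + X]big_ltn // addrCA lerDl.
by apply: addr_ge0; apply: sumr_ge0.
Qed.

Lemma colw_ge0 A j : 0 <= colw K w A j.
Proof. by apply: sumr_ge0 => i _; case: ifP. Qed.

Lemma wt_ge0 A a b : 0 <= wt K w A a b.
Proof. by apply: sumr_ge0 => j _; exact: colw_ge0. Qed.

Lemma wt_cat A a b c : (a <= b <= c)%N -> wt K w A a c = wt K w A a b + wt K w A b c.
Proof. by move=> /andP[ab bc]; rewrite /wt (big_cat_nat ab bc). Qed.

(* Within [omega] consecutive columns each row contributes at most one cell. *)
Lemma wt_window A e u : indep K omega cfl w A -> 0 <= u ->
  (forall j i, (e <= j < e + omega)%N -> (i < K)%N -> w j i <= u) ->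
  wt K w A e (e + omega) <= K%:R * u.
Proof.
move=> iA u0 hu; rewrite /wt /colw exchange_big_nat /=.
have -> : K%:R * u = \sum_(0 <= i < K) u by rewrite sumr_const_nat subn0 mulr_natl.
apply: ler_sum_nat => i /andP[_ iK].
suff H c : (c <= omega)%N -> \sum_(e <= j < e + c) (if A j i then w j i else 0) <= u.
  exact: H.
elim: c => [|c IH] lc; first by rewrite addn0 big_geq.
rewrite addnS big_nat_recr ?leq_addr //=; case: ifPn => Ac; last first.
  by rewrite addr0 IH // ltnW.
rewrite big_nat_cond big1 ?add0r; first by apply: hu => //; lia.
move=> j /andP[/andP[ej jc] _]; case: ifPn => // Aj.
have [_ _ h _] := iA _ _ Ac; have := h j jc Aj; lia.
Qed.

(** A relation that determines [u], so that the running maximum of the program is identified with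
    [bmax] whatever the order of the comparisons. The default is 0. *)
Definition max_of P u := [/\ 0 <= u, forall j i, P j i -> w j i <= u
  & u = 0 \/ exists j i, P j i /\ w j i = u].

Lemma max_of0 : max_of (fun _ _ => false) 0.
Proof. by split=> //; left. Qed.

Lemma max_of_ext P Q u : (forall j i, P j i = Q j i) -> max_of P u -> max_of Q u.
Proof.
move=> h [u0 hu hx]; split=> // [j i|]; first by rewrite -h; exact: hu.
by case: hx => [|[j [i []]]]; [left|rewrite h; right; exists j, i].
Qed.

Lemma max_of_step P u j i : max_of P u ->
  max_of (fun j' i' => P j' i' || ((j' == j) && (i' == i))) (Num.max u (w j i)).
Proof.
move=> [u0 hu hx]; split=> [|j' i'|]; first by rewrite le_max u0.
  by rewrite le_max => /orP[/hu->//|/andP[/eqP-> /eqP->]]; rewrite lexx orbT.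
case: leP => h; last first.
  by case: hx => [|[j' [i' [Pj e]]]]; [left|right; exists j', i'; rewrite Pj].
by right; exists j, i; rewrite !eqxx orbT.
Qed.

Lemma max_of_inj P u v : max_of P u -> max_of P v -> u = v.
Proof.
move=> [u0 hu hx] [v0 hv hy]; apply/eqP; rewrite eq_le; apply/andP; split.
  by case: hx => [->//|[j [i [Pj <-]]]]; exact: hv.
by case: hy => [->//|[j [i [Pj <-]]]]; exact: hu.
Qed.

Definition block (b j i : nat) : bool := (b * omega < j <= b.+1 * omega)%N && (i < K)%N.

Definition bmax (b : nat) : R :=
  foldr (fun c u => Num.max u (w c.1 c.2)) 0
    [seq (j, i) | j <- iota (b * omega).+1 omega, i <- iota 0 K].

Lemma bmaxP b : max_of (block b) (bmax b).
Proof.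
rewrite /bmax; set s := (X in foldr _ _ X).
apply: (@max_of_ext (fun j i => (j, i) \in s)) => [j i|].
  rewrite /s /block; apply/allpairsP/idP => [[[j' i'] /= []]|h].
    by rewrite !mem_iota => h1 h2 [-> ->]; rewrite mulSn; lia.
  by exists (j, i); rewrite /= !mem_iota; move: h; rewrite mulSn; split => //; lia.
elim: s => [|[j i] s IH] /=; first exact: max_of0.
apply: max_of_ext (max_of_step _ _ j i IH) => j' i'.
by rewrite in_cons xpair_eqE orbC.
Qed.

Lemma bmax_ge0 b : 0 <= bmax b.
Proof. by have [] := bmaxP b. Qed.

(* Blocks of the same parity do not interact. *)
Lemma sum_bmax_parity (opt : R) (pi : bool) N : (forall A N, indep K omega cfl w A -> wt K w A 1 N <= opt) ->
  \sum_(0 <= b < N) (if odd b == pi then bmax b else 0) <= opt.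
Proof.
move=> hopt.
(* [None] stands for a block of maximum 0: [indep] admits no cell of weight 0, and such a block adds
   nothing to the sum. *)
have /choice[am hm] : forall b, exists c : option (nat * nat),
    if c is Some (j, i) then [/\ block b j i, w j i = bmax b & 0 < bmax b] else bmax b = 0.
  move=> b; have [u0 _ [->|[j [i [bj e]]]]] := bmaxP b; first by exists None.
  case: (ltP 0 (bmax b)) => h; first by exists (Some (j, i)).
  by exists None; apply/eqP; rewrite eq_le h u0.
pose A j i := [&& (0 < j)%N, odd (j.-1 %/ omega)%N == pi & am (j.-1 %/ omega)%N == Some (j, i)].
have iA : indep K omega cfl w A.
  move=> j i /and3P[j0 o /eqP e]; have := hm (j.-1 %/ omega)%N; rewrite e => -[hb wE u0].
  split=> [||j' lt|i' lt]; first by case/andP: hb.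
  - by rewrite wE.
  - case/and3P=> j0' o' /eqP e'.
    case: (eqVneq (j'.-1 %/ omega)%N (j.-1 %/ omega)%N) => [eb|neb].
      by move: e'; rewrite eb e => -[ej]; rewrite ej ltnn in lt.
    have le : (j'.-1 %/ omega <= j.-1 %/ omega)%N by apply: leq_div2r; lia.
    have := hm (j'.-1 %/ omega)%N; rewrite e' => -[/andP[hb' _] _ _].
    move: hb => /andP[hb _]; move: le neb o o' hb hb'; clear.
    move: (j.-1 %/ omega)%N (j'.-1 %/ omega)%N => b b' le neb /eqP <- /eqP o h1 h2.
    have : (b' + 2 <= b)%N.
      have ne : b != b'.+1 by apply/eqP => e; move: o; rewrite e /=; case: odd.
      lia.
    by move=> h3; have : ((b' + 2) * omega <= b * omega)%N; [rewrite leq_mul2r h3 orbT|nia].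
  - by case/and3P=> _ _ /eqP; rewrite e => -[ei]; rewrite ei ltnn in lt.
apply: le_trans (hopt A (N * omega).+1 iA).
elim: N => [|N IH]; first by rewrite big_geq // /wt big_geq.
rewrite big_nat_recr //= (@wt_cat _ 1 (N * omega).+1); last by rewrite mulSn; lia.
apply: lerD IH _; case: eqP => o; last exact: wt_ge0.
have := hm N; case e : (am N) => [[j i]|] h; last by rewrite h wt_ge0.
have [/andP[hb iK] wE u0] := h; rewrite -wE.
have eb : (j.-1 %/ omega = N)%N.
  have -> : (j.-1 = N * omega + (j - (N * omega).+1))%N by lia.
  by rewrite divnMDl // divn_small ?addn0 //; move: hb; rewrite mulSn; lia.
have hA : A j i by rewrite /A eb o eqxx e eqxx; move: hb; lia.
have <- : (if A j i then w j i else 0) = w j i by rewrite hA.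
apply: (@le_trans _ _ (colw K w A j)).
  by apply: (@ler_sum_term (fun i => if A j i then w j i else 0)) => // i'; case: ifP.
by apply: (@ler_sum_term (colw K w A)) => [|i']; [lia|exact: colw_ge0].
Qed.

Lemma sum_bmax (opt : R) N : (forall A N, indep K omega cfl w A -> wt K w A 1 N <= opt) ->
  \sum_(0 <= b < N) bmax b <= 2 * opt.
Proof.
move=> hopt; rewrite mulr2n mulrDl mul1r.
apply: le_trans (lerD (sum_bmax_parity _ false N hopt) (sum_bmax_parity _ true N hopt)).
rewrite -big_split /=; apply: ler_sum => b _.
by case: (odd b); rewrite /= ?addr0 ?add0r.
Qed.

End BlockMaxima.
(** * Weakest preconditions with time bounds *)

Section ProgramLogic.
Context {R : realType}.
Variables (n L : nat) (inp : seq nat -> R).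
Implicit Types (s : state R) (Q : state R -> Prop).

Definition wp (c : cmd) s (T : nat) Q : Prop :=
  exists t s', [/\ exec n L inp c s t s', (t <= T)%N & Q s'].

Lemma wp_mono c s T T' Q Q' : wp c s T Q -> (T <= T')%N -> (forall s, Q s -> Q' s) ->
  wp c s T' Q'.
Proof.
by move=> [t [s' [h lt q]]] le hQ; exists t, s'; split=> //; [exact: leq_trans le|exact: hQ].
Qed.

Lemma wp_le c s T T' Q : (T <= T')%N -> wp c s T Q -> wp c s T' Q.
Proof. by move=> le h; apply: wp_mono h le _. Qed.

Lemma wp_seq c1 c2 s T1 T2 Q :
  wp c1 s T1 (fun s1 => wp c2 s1 T2 Q) -> wp (Seq c1 c2) s (T1 + T2).+1 Q.
Proof.
move=> [t1 [s1 [h1 l1 [t2 [s2 [h2 l2 q]]]]]]; exists (t1 + t2).+1, s2; split=> //.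
  exact: ESeq h1 h2.
by rewrite ltnS leq_add.
Qed.

Lemma wp_while_step b c s T1 T2 Q : beval s b ->
  wp c s T1 (fun s1 => wp (While b c) s1 T2 Q) -> wp (While b c) s (bcost b + T1 + T2).+1 Q.
Proof.
move=> hb [t1 [s1 [h1 l1 [t2 [s2 [h2 l2 q]]]]]].
exists (bcost b + t1 + t2).+1, s2; split=> //; first exact: EWhileTrue h1 h2.
by rewrite ltnS -!addnA leq_add2l leq_add.
Qed.

Lemma wp_while_end b c s (Q : state R -> Prop) : ~~ beval s b -> Q s ->
  wp (While b c) s (bcost b).+1 Q.
Proof. by move=> hb q; exists (bcost b).+1, s; split=> //; exact: EWhileFalse. Qed.

(** The final failing test is charged as a whole round, hence [N.+1] rounds. *)
Lemma wp_for (I : nat -> state R -> Prop) b c N T s Q : I 0 s ->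
  (forall j s, (j < N)%N -> I j s -> beval s b /\ wp c s T (I j.+1)) ->
  (forall s, I N s -> ~~ beval s b /\ Q s) ->
  wp (While b c) s (N.+1 * (bcost b + T).+1) Q.
Proof.
move=> I0 step last.
suff H k j s1 : (k + j = N)%N -> I j s1 -> wp (While b c) s1 (k.+1 * (bcost b + T).+1) Q.
  exact: (H N 0 s (addn0 N) I0).
elim: k j s1 => [|k IH] j s1 e Ij.
  rewrite add0n in e; subst j; have [hb q] := last _ Ij.
  by apply: wp_mono (wp_while_end _ _ _ _ hb q) _ _ => //; lia.
have [|hb hw] := step j s1 _ Ij; first by lia.
apply: (@wp_mono _ _ (bcost b + T + k.+1 * (bcost b + T).+1).+1 _ Q) => //.
apply: wp_while_step => //; apply: wp_mono hw _ _ => // s2 I2.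
by apply: IH I2; lia.
Qed.

(** Loops over rows are unrolled when the program is written, since [K] depends on [d] and [k] only;
    each copy contains its row number as a constant. *)
Fixpoint seqs (f : nat -> cmd) (k : nat) : cmd :=
  if k is k'.+1 then Seq (seqs f k') (f k') else Skip.

Lemma wp_seqs (I : nat -> state R -> Prop) f k T s Q : I 0 s ->
  (forall r s, (r < k)%N -> I r s -> wp (f r) s T (I r.+1)) ->
  (forall s, I k s -> Q s) -> wp (seqs f k) s (k * T.+1).+1 Q.
Proof.
elim: k Q => [|k IH] Q I0 step last /=.
  by exists 1%N, s; split=> //; [exact: ESkip|exact: last].
apply: (@wp_mono _ _ ((k * T.+1).+1 + T).+1 _ Q) => //; last by rewrite mulSn; lia.
apply: wp_seq; apply: IH => // [r s1 rk|s1 I1]; first by apply: step; exact: ltnW.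
by apply: wp_mono (step _ _ _ I1) _ _.
Qed.

Fixpoint lcost (c : cmd) : nat :=
  match c with
  | Skip | Advance => 1
  | NSet _ i e => (ncost i + ncost e).+1
  | RSet _ i e => (ncost i + rcost e).+1
  | Query _ i j es => (ncost i + ncost j + scost es).+1
  | HasColumn _ i j => (ncost i + ncost j).+1
  | Select es => (scost es).+1
  | Seq c1 c2 => (lcost c1 + lcost c2).+1
  | If b c1 c2 => (bcost b + maxn (lcost c1) (lcost c2)).+1
  | While _ _ => 0
  end.

(** Straight-line code only: [While] is sent to [False], which makes its cost 0 in [lcost]
    harmless. *)
Fixpoint wpc (c : cmd) s Q : Prop :=
  match c with
  | Skip => Q s
  | NSet a i e => Q (set_n s a (neval s i) (neval s e))
  | RSet a i e => Q (set_r s a (neval s i) (reval s e))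
  | Query a i j es => (neval s j <= pos s + L)%N /\
      Q (set_r s a (neval s i) (inp (neval s j :: map (neval s) es)))
  | HasColumn a i j => (neval s j <= pos s + L)%N /\
      Q (set_n s a (neval s i) (0 < neval s j <= n)%N)
  | Select es => Q (add_out s (pos s :: map (neval s) es))
  | Advance => Q (set_pos s (pos s).+1)
  | Seq c1 c2 => wpc c1 s (fun s1 => wpc c2 s1 Q)
  | If b c1 c2 => if beval s b then wpc c1 s Q else wpc c2 s Q
  | While _ _ => False
  end.

Lemma wpc_wp c s Q : wpc c s Q -> wp c s (lcost c) Q.
Proof.
elim: c s Q => /=.
- by move=> s Q q; exists 1%N, s; split=> //; constructor.
- by move=> a i e s Q q; eexists _, _; split; [exact: ENSet| |exact: q].
- by move=> a i e s Q q; eexists _, _; split; [exact: ERSet| |exact: q].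
- by move=> a i j es s Q [hj q]; eexists _, _; split; [exact: EQuery| |exact: q].
- by move=> a i j s Q [hj q]; eexists _, _; split; [exact: EHasColumn| |exact: q].
- by move=> es s Q q; eexists _, _; split; [exact: ESelect| |exact: q].
- by move=> s Q q; eexists _, _; split; [exact: EAdvance| |exact: q].
- move=> c1 IH1 c2 IH2 s Q q; apply: wp_seq; apply: wp_mono (IH1 _ _ q) _ _ => // s1.
  exact: IH2.
- move=> b c1 IH1 c2 IH2 s Q; case: ifPn => hb.
    move=> /IH1[t [s' [h l q]]]; exists (bcost b + t).+1, s'; split=> //.
      exact: EIfTrue.
    by rewrite ltnS leq_add2l leq_max l.
  move=> /IH2[t [s' [h l q]]]; exists (bcost b + t).+1, s'; split=> //.
    exact: EIfFalse.
  by rewrite ltnS leq_add2l leq_max l orbT.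
- by [].
Qed.

End ProgramLogic.

Lemma leq_bigmax_nat (F : nat -> nat) k i : (i < k)%N -> (F i <= \max_(j < k) F j)%N.
Proof. by move=> ik; exact: (leq_bigmax (Ordinal ik)). Qed.
(** * The program *)

Section Program.
Variables (K : nat) (rw : nat -> seq nat) (cfs : rel nat) (dst : nat -> nat -> nat).

(* Scalars are kept at index 0 of their own array.  Naturals: array 0 holds
   omega, 1 the powers of omega, 2 the number [M] of candidate blocks for a cut,
   3 that number times omega, 4 the current column, 5-8 and 10 counters and
   bounds, 9 a pointer into the table, and [adig i] the [i]-th digit of every
   state.  Reals: 0 holds eps, 1 the lightest block maximum (before that, the
   multiples of eps), 2 the current block maximum, 3 a cell weight, and 4 the
   dynamic programming table, in which [value q x] is stored at
   [q * omega ^ K + x]. *)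
Definition adig (i : nat) : nat := i.+4.+4.+3.
Definition nv (a : nat) : nexp := NGet a (NConst 0).
Definition rv (a : nat) : rexp := RGet a (NConst 0).
Definition nset (a : nat) (e : nexp) : cmd := NSet a (NConst 0) e.
Definition rset (a : nat) (e : rexp) : cmd := RSet a (NConst 0) e.
Definition incr (a : nat) : cmd := nset a (NAdd (nv a) (NConst 1)).
Definition blt (e1 e2 : nexp) : bexp := BLeN (NAdd e1 (NConst 1)) e2.
Definition npow (i : nat) : nexp := NGet 1 (NConst i).
Definition ndig (i : nat) : nexp := NGet (adig i) (nv 6).
Definition query (a i : nat) : cmd := Query 3 (NConst 0) (nv a) (map NConst (rw i)).

(** Adjacency and distance of two rows are constants of the program; only the comparisons with
    [omega] remain for run time. The last branch is a constant false. *)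
Definition bclash (i' i : nat) : bexp :=
  if cfs i' i then
    BAnd (BLeN (NConst (dst i' i).+1) (nv 0)) (BLeN (nv 0) (NAdd (ndig i') (NConst 1)))
  else BNot (BLeN (NConst 0) (NConst 0)).

Definition bfree (i : nat) : bexp :=
  BAnd (BLeN (ndig i) (NConst 0)) (BAnd (BNot (BLeR (rv 3) RZero))
    (foldr (fun i' b => BAnd (BNot (bclash i' i)) b) (BLeN (NConst 0) (NConst 0)) (iota 0 i))).

Definition nput (i : nat) : nexp := NAdd (nv 6) (NSub (npow i.+1) (npow i)).
Definition ndec (i : nat) : nexp := NSub (nv 6) (npow i).
Definition tab (e : nexp) : rexp := RGet 4 (NAdd (nv 9) e).

(** Both passes share this test, so the replay repeats the tabulated decisions. Pointer 9 is at
    layer [value q] in both: the backward pass raises it after a cell, the forward pass lowers it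
    before one. *)
Definition btake (i : nat) : bexp :=
  BAnd (bfree i) (BLeR (tab (nv 6)) (RAdd (rv 3) (tab (nput i)))).

Definition backward_state (i : nat) : cmd :=
  let target := NAdd (nv 9) (NAdd (npow K) (nv 6)) in
  Seq (If (btake i) (RSet 4 target (RAdd (rv 3) (tab (nput i))))
      (If (BLeN (NConst 1) (ndig i)) (RSet 4 target (tab (ndec i)))
        (RSet 4 target (tab (nv 6)))))
    (incr 6).

Definition backward_cell (i : nat) : cmd :=
  Seq (Seq (query 5 i) (nset 6 (NConst 0)))
    (Seq (While (blt (nv 6) (npow K)) (backward_state i))
      (nset 9 (NAdd (nv 9) (npow K)))).

Definition backward : cmd :=
  Seq (Seq (nset 5 (nv 10)) (nset 9 (NConst 0)))
    (While (blt (nv 4) (nv 5))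
      (Seq (nset 5 (NSub (nv 5) (NConst 1))) (seqs (fun r => backward_cell (K.-1 - r)) K))).

Definition forward_cell (i : nat) : cmd :=
  Seq (Seq (query 4 i) (nset 9 (NSub (nv 9) (npow K))))
    (If (btake i) (Seq (Select (map NConst (rw i))) (nset 6 (nput i)))
      (If (BLeN (NConst 1) (ndig i)) (nset 6 (ndec i)) Skip)).

Definition forward : cmd :=
  Seq (nset 6 (NConst 0))
    (While (blt (nv 4) (nv 10)) (Seq (seqs forward_cell K) (Seq Advance (incr 4)))).

Definition skip_block : cmd :=
  Seq (nset 5 (NConst 0))
    (While (blt (nv 5) (nv 0)) (Seq Advance (Seq (incr 4) (incr 5)))).

Definition search_cell (i : nat) : cmd :=
  Seq (query 10 i) (If (BLeR (rv 2) (rv 3)) (rset 2 (rv 3)) Skip).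

Definition search_block : cmd :=
  Seq (Seq (rset 2 RZero) (nset 6 (NConst 0)))
    (While (blt (nv 6) (nv 0)) (Seq (seqs search_cell K) (Seq (incr 10) (incr 6)))).

(** The first candidate is accepted unconditionally, because real array 1 still holds an older
    value. Counter 10 has passed the block by then, whence the subtraction of [omega]. Blocks beyond
    the last column read as weight 0 and need no special case. *)
Definition search : cmd :=
  Seq (Seq (nset 10 (NAdd (nv 4) (nv 3))) (nset 5 (NConst 0)))
    (While (blt (nv 5) (nv 2))
      (Seq search_block
        (Seq (If (BAnd (BLeN (NConst 1) (nv 5)) (BNot (BLeR (rv 2) (rv 1)))) Skip
               (Seq (rset 1 (rv 2)) (nset 7 (NSub (nv 10) (nv 0)))))
          (incr 5)))).

(** Moves counter 10 to the cut or to the first missing column, whichever comes first, so that table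
    time is spent on existing columns only. *)
Definition scan : cmd :=
  Seq (Seq (nset 10 (nv 4)) (HasColumn 8 (NConst 0) (nv 10)))
    (While (BAnd (blt (nv 10) (nv 7)) (BLeN (NConst 1) (nv 8)))
      (Seq (incr 10) (HasColumn 8 (NConst 0) (nv 10)))).

Definition segment : cmd :=
  Seq (Seq search scan) (Seq backward (Seq forward skip_block)).

Definition look : cmd := HasColumn 8 (NConst 0) (nv 4).

Definition main_loop : cmd := While (BLeN (NConst 1) (nv 8)) (Seq segment look).

Definition count : cmd :=
  While (BNot (BLeR ROne (rv 1))) (Seq (rset 1 (RAdd (rv 1) (rv 0))) (incr 2)).

(** A product with a constant factor such as [2 * K] unrolls into one expression; products with
    [omega] need a loop. *)
Definition nscale (c : nat) (e : nexp) : nexp := iter c (NAdd e) (NConst 0).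

Definition power (i : nat) : cmd :=
  Seq (Seq (NSet 1 (NConst i.+1) (NConst 0)) (nset 6 (NConst 0)))
    (While (blt (nv 6) (nv 0))
      (Seq (NSet 1 (NConst i.+1) (NAdd (npow i.+1) (npow i))) (incr 6))).

Definition digits_step (i : nat) : cmd :=
  let previous := NAdd (NGet (adig i) (ndec i)) (NConst 1) in
  Seq (If (blt (nv 6) (npow i)) (NSet (adig i) (nv 6) (NConst 0))
        (If (blt previous (nv 0)) (NSet (adig i) (nv 6) previous)
          (NSet (adig i) (nv 6) (NConst 0))))
    (incr 6).

Definition digits (i : nat) : cmd :=
  Seq (nset 6 (NConst 0)) (While (blt (nv 6) (npow K)) (digits_step i)).

Definition multiply : cmd :=
  Seq (Seq (nset 2 (nscale (2 * K) (NAdd (nv 2) (NConst 1))))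
      (Seq (nset 3 (NConst 0)) (nset 6 (NConst 0))))
    (While (blt (nv 6) (nv 0)) (Seq (nset 3 (NAdd (nv 3) (nv 2))) (incr 6))).

Definition setup : cmd :=
  Seq (Seq (Seq count multiply) (Seq (NSet 1 (NConst 0) (NConst 1)) (seqs power K)))
    (seqs digits K).

Definition program : cmd :=
  Seq setup (Seq (Seq (nset 4 (NConst 1)) look) main_loop).

(** * Invariants and running time of the program *)

Section Semantics.
Context {R : realType}.
Variables (n L : nat) (inp : seq nat -> R) (omega M : nat).
Hypotheses (K_gt0 : (0 < K)%N) (omega_gt0 : (0 < omega)%N) (M_gt0 : (0 < M)%N).
Hypothesis dst_gt0 : forall i i', cfs i i' -> (0 < dst i i')%N.
Hypothesis L_large : (2 * M * omega <= L)%N.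
Implicit Types s : state R.
Local Notation wp := (wp n L inp).
Local Notation wpc := (wpc n L inp).
Local Notation W := (omega ^ K)%N.

Definition cflict (i' i : nat) : bool := cfs i' i && (dst i' i < omega)%N.
Definition cellw (j i : nat) : R := inp (j :: rw i).
Local Notation w := cellw.
Local Notation cfl := cflict.

Lemma cfl_omega i i' : cfl i i' -> (1 < omega)%N.
Proof. by case/andP => /dst_gt0; exact: leq_ltn_trans. Qed.

(** The last clause is layer 0 of the table, [value 0]. It is never overwritten, so every segment
    can rebuild its table on top of it. *)
Definition base s := [/\ nmem s 0 0 = omega,
   forall i, (i <= K)%N -> nmem s 1 i = (omega ^ i)%N,
   nmem s 2 0 = M /\ nmem s 3 0 = (M * omega)%N,
   forall i x, (i < K)%N -> (x < W)%N -> nmem s (adig i) x = dig omega i x &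
   forall x, (x < W)%N -> rmem s 4 x = 0].

Definition ctx p o s := [/\ base s, pos s = p, out s = o & nmem s 4 0 = p].

Lemma base_set_n s a i v : (3 < a < 11)%N -> base s -> base (set_n s a i v).
Proof.
move=> ha [h0 h1 [h2 h3] h4 h5].
have D b : (b <= 3)%N || (11 <= b)%N -> (b == a) = false by lia.
split=> //=; rewrite /upd.
- by rewrite D.
- by move=> j hj; rewrite D //= h1.
- by rewrite !D.
- by move=> j x hj hx; rewrite D ?h4 // /adig; lia.
Qed.

Lemma base_set_r s a i v : a != 4%N -> base s -> base (set_r s a i v).
Proof.
by move=> ha [h0 h1 h2 h4 h5]; split=> //= x hx; rewrite /upd eq_sym (negbTE ha) h5.
Qed.

Lemma base_set_tab s i v : (W <= i)%N -> base s -> base (set_r s 4 i v).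
Proof.
move=> hi [h0 h1 h2 h4 h5]; split=> //= x hx; rewrite /upd /=.
by case: eqP => [e|_]; [lia|exact: h5].
Qed.

Lemma beval_btake s i : base s -> (i < K)%N -> (nmem s 6 0 < W)%N ->
  beval s (btake i) =
  take_test omega cfl i (rmem s 3 0) (fun y => rmem s 4 (nmem s 9 0 + y)) (nmem s 6 0).
Proof.
move=> [h0 h1 [h2 h3] h4 h5] iK xW.
rewrite /btake /bfree /take_test /free /= !h1 // ?(ltnW iK) // -!andbA !h4 // leqn0 -ltNge.
congr [&& _, _ & _]; congr (_ && _).
have : all (fun i' => i' < K)%N (iota 0 i) by apply/allP => i'; rewrite mem_iota; lia.
elim: (iota 0 i) => [|i' l IH] //= /andP[i'K /IH ->]; congr (~~ _ && _).
by rewrite /bclash /cfl; case: cfs => //=; rewrite h0 h4 // addn1.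
Qed.


Local Opaque btake.

Lemma ctx_set_n p o s a i v : (4 < a < 11)%N -> ctx p o s -> ctx p o (set_n s a i v).
Proof.
move=> ha [b hp ho h4]; split=> //; first by apply: base_set_n => //; lia.
by rewrite /= /upd; have -> : (4 == a) = false by lia.
Qed.

Lemma ctx_set_tab p o s i v : (W <= i)%N -> ctx p o s -> ctx p o (set_r s 4 i v).
Proof. by move=> hi [b hp ho h4]; split=> //; exact: base_set_tab. Qed.

Lemma map_neval_const s l : map (neval s) (map NConst l) = l.
Proof. by rewrite -map_comp map_id_in. Qed.

Lemma take_test_ext i c (V V' : nat -> R) x : (i < K)%N -> (x < W)%N ->
  (forall y, (y < W)%N -> V y = V' y) ->
  take_test omega cfl i c V x = take_test omega cfl i c V' x.
Proof.
move=> iK xW h; rewrite /take_test; case: (boolP (free _ _ _ _ _)) => //= fr.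
rewrite !h //; apply: put_lt => //; by case/and3P: fr => /eqP.
Qed.

(** * The backward pass *)

Section Backward.
Variables (p : nat) (o : seq (seq nat)) (ec : nat).
Local Notation value := (value K omega cfl w ec).
Local Notation crow := (crow K).
Local Notation ccol := (ccol K ec).

Definition table q s := forall q' x, (q' <= q)%N -> (x < W)%N ->
  rmem s 4 (q' * W + x) = value q' x.

Definition cell_inv q s :=
  [/\ ctx p o s, nmem s 10 0 = ec, nmem s 9 0 = (q * W)%N & table q s].

Definition state_inv a q x s :=
  [/\ cell_inv q s, nmem s 5 0 = a, nmem s 6 0 = x, rmem s 3 0 = w (ccol q) (crow q)
    & forall y, (y < x)%N -> rmem s 4 (q.+1 * W + y) = value q.+1 y].

Lemma state_inv_next a q x s v : (x < W)%N -> state_inv a q x s -> v = value q.+1 x ->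
  state_inv a q x.+1 (set_n (set_r s 4 (q * W + (W + x)) v) 6 0 (x + 1)).
Proof.
move=> xW [[hc h10 h9 ht] h5 h6 h3 hy] hv.
have e : (q * W + (W + x) = q.+1 * W + x)%N by rewrite mulSn; lia.
split=> //=; last 2 first.
- by rewrite /upd /= addn1.
- move=> y; rewrite ltnS leq_eqVlt /upd /= e eqn_add2l => /orP[/eqP->|lt].
    by rewrite eqxx.
  by rewrite ltn_eqF // hy.
split=> //; first by apply: ctx_set_n => //; apply: ctx_set_tab => //; lia.
move=> q' y le yW; rewrite /= /upd /=.
have : (q' * W + y < q * W + (W + x))%N.
  by rewrite e mulSn; have : (q' * W <= q * W)%N; [rewrite leq_mul2r le orbT|lia].
by move=> lt; rewrite (ltn_eqF lt) ht.
Qed.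

Lemma backward_stateP a q x s : (x < W)%N -> state_inv a q x s ->
  wpc (backward_state (crow q)) s (state_inv a q x.+1).
Proof.
move=> xW inv; have [[hc h10 h9 ht] h5 h6 h3 hy] := inv; have [hb hp ho h4] := hc.
have iK := crow_lt K K_gt0 q.
have [b0 b1 _ b4 _] := hb.
rewrite /= beval_btake // ?h6 // !b1 ?(ltnW iK) // h9 b4 //.
have hV y : (y < W)%N -> rmem s 4 (q * W + y) = value q y by move=> yW; rewrite ht.
rewrite (take_test_ext _ _ _ (value q)) // ?h3.
have vE : value q.+1 x = step omega cfl (crow q) (w (ccol q) (crow q)) (value q) x by [].
case: ifPn => tt.
  apply: (state_inv_next _ _ _ _ _ xW inv).
  rewrite vE /step tt hV //; apply: put_lt => //.
  by case/andP: tt => /and3P[/eqP].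
case: ifPn => d; apply: (state_inv_next _ _ _ _ _ xW inv);
  rewrite vE /step (negbTE tt) /dec.
  by rewrite d hV //; exact: leq_ltn_trans (leq_subr _ _) xW.
by rewrite (negbTE d) hV.
Qed.

(** Like all the [cost_] constants it depends on the program text only, not on [n], [omega] or
    [eps], and can go into the constant of the O-bound. The factor 2 absorbs [W.+1] rounds into
    [2 * W]; the maximum is needed as the code differs from row to row. *)
Definition cost_backward_cell : nat :=
  \max_(i < K) (lcost (Seq (query 5 i) (nset 6 (NConst 0))) +
     (2 * (bcost (blt (nv 6) (npow K)) + lcost (backward_state i)).+1 +
     lcost (nset 9 (NAdd (nv 9) (npow K)))).+1).+1.

Lemma backward_cellP q s : (q < ec * K)%N -> (ec <= (p + L).+1)%N -> cell_inv q s ->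
  nmem s 5 0 = ccol q ->
  wp (backward_cell (crow q)) s (cost_backward_cell * W)
     (fun s => cell_inv q.+1 s /\ nmem s 5 0 = ccol q).
Proof.
move=> hq hL inv h5; have [hc h10 h9 ht] := inv; have [hb hp ho h4] := hc.
have W_gt0 : (0 < W)%N by rewrite expn_gt0 omega_gt0.
have iK := crow_lt K K_gt0 q.
have hcol : (ccol q < ec)%N.
  have ec0 : (0 < ec)%N by move: hq; rewrite lt0n; apply: contraTneq => ->.
  by rewrite (leq_ltn_trans (leq_subr _ _)) // prednK.
set A := lcost (Seq (query 5 (crow q)) (nset 6 (NConst 0))).
set B := (bcost (blt (nv 6) (npow K)) + lcost (backward_state (crow q))).+1.
set C := lcost (nset 9 (NAdd (nv 9) (npow K))).
apply: (@wp_le _ _ _ _ _ _ ((A + (W.+1 * B + C).+1).+1)).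
  have : ((A + (2 * B + C).+1).+1 <= cost_backward_cell)%N.
    exact: (leq_bigmax_nat (fun i => (lcost (Seq (query 5 i) (nset 6 (NConst 0))) +
     (2 * (bcost (blt (nv 6) (npow K)) + lcost (backward_state i)).+1 +
     lcost (nset 9 (NAdd (nv 9) (npow K)))).+1).+1) _ _ iK).
  move=> h; apply: (@leq_trans ((A + (2 * B + C).+1).+1 * W)).
    by move: W_gt0; clear; move: W A B C => W A B C; nia.
  by rewrite leq_mul2r h orbT.
apply: wp_seq; apply: wpc_wp; rewrite /= map_neval_const h5 hp; split; first by lia.
apply: wp_seq; apply: (wp_for _ _ _ (state_inv (ccol q) q)).
- by split.
- move=> x s1 xW I1; split; last by apply: wpc_wp; exact: backward_stateP.
  have [[[[_ b1 _ _ _] _ _ _] _ _ _] _ h6 _ _] := I1.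
  by rewrite /= h6 b1 // addn1.
move=> s1 [[hc1 g10 g9 gt] g5 g6 g3 gy]; have [[_ b1 _ _ _] _ _ _] := hc1.
split; first by rewrite /= g6 b1 // addn1 ltnn.
apply: wpc_wp; rewrite /= g9 b1 //; split=> //; split=> //.
  by rewrite /= /upd /= mulSn addnC.
move=> q' y; rewrite leq_eqVlt => /orP[/eqP->|le] yW; first exact: gy.
exact: gt.
Qed.

Definition cost_backward_column : nat :=
  (bcost (blt (nv 4) (nv 5)) +
    (lcost (nset 5 (NSub (nv 5) (NConst 1))) + (K * cost_backward_cell.+1).+1).+1).+1.

Definition cost_backward : nat :=
  (lcost (Seq (nset 5 (nv 10)) (nset 9 (NConst 0))) + cost_backward_column).+1.

Lemma backwardP s : (p <= ec <= (p + L).+1)%N -> ctx p o s -> nmem s 10 0 = ec ->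
  wp backward s (cost_backward * ((ec - p).+1 * W)) (cell_inv ((ec - p) * K)).
Proof.
move=> /andP[pe hL] hc h10; have [hb hp ho h4] := hc.
have W_gt0 : (0 < W)%N by rewrite expn_gt0 omega_gt0.
have hcost : (cost_backward_column * W >=
    (bcost (blt (nv 4) (nv 5)) + (lcost (nset 5 (NSub (nv 5) (NConst 1))) +
     (K * (cost_backward_cell * W).+1).+1).+1).+1)%N.
  rewrite /cost_backward_column; move: (bcost _) (lcost _) cost_backward_cell W W_gt0; clear.
  by move=> a b c W h; nia.
apply: (@wp_le _ _ _ _ _ _
  (lcost (Seq (nset 5 (nv 10)) (nset 9 (NConst 0))) + (ec - p).+1 * (cost_backward_column * W)).+1).
- rewrite /cost_backward; move: (lcost _) cost_backward_column W W_gt0; clear.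
  by move=> a b W h; nia.
- apply: wp_seq; apply: wpc_wp; rewrite /= h10.
  pose inv c s := cell_inv (c * K) s /\ nmem s 5 0 = (ec - c)%N.
  apply: (@wp_le _ _ _ _ _ _ ((ec - p).+1 *
    (bcost (blt (nv 4) (nv 5)) + (lcost (nset 5 (NSub (nv 5) (NConst 1))) +
     (K * (cost_backward_cell * W).+1).+1).+1).+1)).
    by rewrite leq_mul2l hcost orbT.
  apply: (wp_for _ _ _ inv).
  + split; last by rewrite /= /upd /= subn0.
    split=> //.
    move=> q' x; rewrite leqn0 => /eqP-> xW; rewrite mul0n add0n /=.
    by have [_ _ _ _ ->] := hb.
  + move=> c s1 cp [I1 h5]; have [hc1 g10 g9 gt] := I1; have [_ _ _ g4] := hc1.
    split; first by rewrite /= g4 h5; lia.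
    apply: wp_seq; apply: wpc_wp; rewrite /= h5.
    pose inv2 r s := cell_inv (c * K + r) s /\ nmem s 5 0 = (ec - c - 1)%N.
    apply: (wp_seqs _ _ _ inv2).
    * split; last by rewrite /upd.
      by rewrite addn0; split.
    * move=> r s2 rK [I2 k5].
      have e1 : crow (c * K + r) = (K.-1 - r)%N by rewrite /crow modnMDl modn_small.
      have e2 : ccol (c * K + r) = (ec - c - 1)%N.
        by rewrite /ccol divnMDl // divn_small // addn0; lia.
      rewrite -e1 /inv2 addnS -e2; apply: backward_cellP => //; last by rewrite e2.
      have : (c.+1 * K <= ec * K)%N by rewrite leq_mul2r; lia.
      by rewrite mulSn; lia.
    * move=> s2 [I2 k5]; split; last by rewrite k5; lia.
      by rewrite mulSn addnC.
  + move=> s1 [I1 h5]; have [[_ _ _ g4] _ _ _] := I1; split=> //.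
    by rewrite /= g4 h5; lia.
Qed.

End Backward.


Hypothesis rw_inj : forall i i', (i < K)%N -> (i' < K)%N -> rw i = rw i' -> i = i'.
Hypothesis w_supp : forall j i, 0 < w j i -> (0 < j <= n)%N.

Definition sel (o : seq (seq nat)) (j i : nat) : bool := (i < K)%N && ((j :: rw i) \in o).
Definition total o : R := wt K w (sel o) 1 n.+1.

Lemma sel_cons o j i : (i < K)%N -> forall j' i',
  sel ((j :: rw i) :: o) j' i' = add_cell (sel o) j i j' i'.
Proof.
move=> iK j' i'; rewrite /sel /add_cell in_cons eqseq_cons andb_orr orbC; congr (_ || _).
case: eqP => [_|//]; rewrite /= ?andbF //=.
apply/andP/eqP => [[i'K /eqP]|->]; last by rewrite eqxx.
exact: rw_inj.
Qed.

Lemma eq_indep A B : (forall j i, A j i = B j i) -> indep K omega cfl w A -> indep K omega cfl w B.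
Proof.
move=> e iA j i; rewrite -e => /iA[h1 h2 h3 h4].
by split=> // [j' lt|i' lt]; rewrite -e; [exact: h3|exact: h4].
Qed.

Lemma eq_wt A B a b : (forall j i, A j i = B j i) -> wt K w A a b = wt K w B a b.
Proof. by move=> e; apply: eq_bigr => j _; apply: eq_bigr => i _; rewrite e. Qed.

(** * The forward pass *)

Section Forward.
Variables (ec : nat) (X : R).
Local Notation value := (value K omega cfl w ec).
Local Notation crow := (crow K).
Local Notation ccol := (ccol K ec).

Definition selected_before (o : seq (seq nat)) q := indep K omega cfl w (sel o) /\
  forall pt, pt \in o -> exists j i, [/\ (i < K)%N, pt = j :: rw i & (j < ndone K ec q i)%N].

(** [X] is a lower bound for the weight already selected plus the value of the segment. Each
    replayed decision preserves it, and at [q = 0], where the value is 0, it bounds the total. *)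
Definition forward_inv q s :=
  [/\ base s /\ pos s = nmem s 4 0, nmem s 10 0 = ec /\ nmem s 9 0 = (q * W)%N,
     table ec q s /\ selected_before (out s) q, stq K omega ec (sel (out s)) q (nmem s 6 0)
   & X <= total (out s) + value q (nmem s 6 0)].

Lemma sel_before o q j i : selected_before o q -> sel o j i -> (j < ndone K ec q i)%N.
Proof.
move=> [_ h] /andP[iK /h[j' [i' [i'K [-> /rw_inj e] lt]]]].
by rewrite e.
Qed.

Lemma forward_cellP q s : (q < ec * K)%N -> forward_inv q.+1 s -> nmem s 4 0 = ccol q ->
  wpc (forward_cell (crow q)) s (fun s => forward_inv q s /\ nmem s 4 0 = ccol q).
Proof.
move=> hq [[hb hp] [h10 h9] [ht hs] hx hX] h4; have [b0 b1 _ b4 _] := hb.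
have h : (q %/ K < ec)%N by rewrite ltn_divLR.
have iK := crow_lt K K_gt0 q; have [xW dx] := hx; have [iS lS] := hs.
have nS : ~~ sel (out s) (ccol q) (crow q).
  by apply/negP => /(sel_before _ _ _ _ hs); rewrite ndone_row // ltnn.
have ht' : table ec q s by move=> q' x le; apply: ht; exact: leqW.
have hs' : selected_before (out s) q.
  split=> // pt /lS[j [i [i'K e lt]]]; exists j, i; split=> //.
  exact: leq_trans lt (ndone_le _ _ _ _).
rewrite /= map_neval_const hp h4; split; first exact: leq_addr.
set s1 := set_n _ 9 _ _.
have e9 : nmem s1 9 0 = (q * W)%N by rewrite /s1 /= /upd /= b1 // h9 mulSn addKn.
have hb1 : base s1 by apply: base_set_n => //; exact: base_set_r.
rewrite beval_btake // e9.
rewrite (take_test_ext _ _ _ (value q)) //; last by move=> y yW; exact: ht'.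
have -> : rmem s1 3 0 = w (ccol q) (crow q) by [].
have -> : nmem s1 6 0 = nmem s 6 0 by [].
rewrite /upd /= !b1 ?(ltnW iK) // b4 //.
have vE : value q.+1 (nmem s 6 0) = step omega cfl (crow q) (w (ccol q) (crow q)) (value q) (nmem s 6 0) by [].
have fin x' o' : X <= total o' + value q x' -> stq K omega ec (sel o') q x' ->
    selected_before o' q -> o' = out s ->
    forward_inv q (set_n s1 6 0 x').
  move=> hX' hx' hs2 eo; split=> //=; rewrite -?eo //; split=> //.
case: ifPn => tt.
  have fr : free omega cfl (crow q) (nmem s 6 0) (w (ccol q) (crow q)) by case/andP: tt.
  have d0 : dig omega (crow q) (nmem s 6 0) = 0%N by case/and3P: fr => /eqP.
  have w0 : 0 < w (ccol q) (crow q) by case/and3P: fr.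
  have eS := sel_cons (out s) (ccol q) (crow q) iK.
  rewrite map_neval_const h4; split=> //; split=> //=.
  - split; first by [].
    split.
      apply: (eq_indep (add_cell (sel (out s)) (ccol q) (crow q))) => [j i|].
        by rewrite eS.
      apply: (indep_add _ _ _ _ K_gt0 omega_gt0 cfl_omega _ _ _ _ _ h iS _ hx fr) => // j i.
      exact: sel_before.
    move=> pt; rewrite in_cons => /orP[/eqP->|]; last by move/(proj2 hs').
    by exists (ccol q), (crow q); split=> //; rewrite ndone_step // eqxx ndone_row.
  - rewrite /upd /=.
    have -> : sel ((ccol q :: rw (crow q)) :: out s) = add_cell (sel (out s)) (ccol q) (crow q).
      by apply/funext => j; apply/funext => i; rewrite eS.
    apply: stq_put => //; last by rewrite /add_cell !eqxx orbT.
    (* The new cell lies at the horizon of its row, not below it, so it does not affect the state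
       before it is processed. *)
    split=> // i iK'; rewrite dx //; apply: eq_rem => j lt.
    rewrite /add_cell; case: (boolP (_ && _)) => [/andP[/eqP ej /eqP ei]|_]; last by rewrite orbF.
    by subst; rewrite ndone_row // ltnn in lt.
  - rewrite /upd /= /total (eq_wt _ _ _ _ eS) wt_add //; last first.
      by have := w_supp _ _ w0; rewrite ltnS.
    by move: hX; rewrite vE /step tt addrA.
have nt := negbTE tt.
case: ifPn => d.
  split=> //; apply: (fin _ (out s)) => //.
    by move: hX; rewrite vE /step nt /dec d.
  by have := stq_dec K omega K_gt0 omega_gt0 ec _ _ _ h hx nS; rewrite /dec d.
split=> //.
(* The unchanged state is presented as a trivial write, so that [fin] covers this case too. *)
have e : set_n s1 6 0 (nmem s 6 0) = s1.
  rewrite /set_n /s1 /=; congr State; apply/funext => a; apply/funext => b.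
  by rewrite {1}/upd; case: andP => // -[/eqP-> /eqP->].
rewrite -e; apply: (fin _ (out s)) => //.
  by move: hX; rewrite vE /step nt /dec (negbTE d).
by have := stq_dec K omega K_gt0 omega_gt0 ec _ _ _ h hx nS; rewrite /dec (negbTE d).
Qed.


Definition cost_forward_column : nat :=
  (bcost (blt (nv 4) (nv 10)) + ((K * (\max_(i < K) lcost (forward_cell i)).+1).+1 +
    lcost (Seq Advance (incr 4))).+1).+1.

Definition cost_forward : nat := (lcost (nset 6 (NConst 0)) + cost_forward_column).+1.

Lemma forwardP p o s : (p <= ec)%N -> cell_inv p o ec ((ec - p) * K) s ->
  indep K omega cfl w (sel o) ->
  (forall pt, pt \in o -> exists j i, [/\ (i < K)%N, pt = j :: rw i & (j + omega <= p)%N]) ->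
  X <= total o + value ((ec - p) * K) 0 ->
  wp forward s (cost_forward * (ec - p).+1) (fun s =>
    [/\ base s, pos s = ec, nmem s 4 0 = ec, selected_before (out s) 0 & X <= total (out s)]).
Proof.
move=> pe [hc h10 h9 ht] iO hO hX; have [hb hp ho h4] := hc.
apply: (@wp_le _ _ _ _ _ _ ((lcost (nset 6 (NConst 0)) + (ec - p).+1 * cost_forward_column).+1)).
  by rewrite /cost_forward; move: (lcost _) cost_forward_column; clear; nia.
apply: wp_seq; apply: wpc_wp.
pose inv c s := forward_inv ((ec - p - c) * K) s /\ nmem s 4 0 = (p + c)%N.
have nd i : (i < K)%N -> ndone K ec ((ec - p) * K) i = p.
  by move=> iK; rewrite ndone_mul //; lia.
apply: (wp_for _ _ _ inv).
- rewrite /inv subn0 addn0; split=> //; split=> //=.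
  + by rewrite hp.
  + split=> //; rewrite ho; split=> // pt /hO[j [i [iK e le]]].
    by exists j, i; split=> //; rewrite nd //; lia.
  + rewrite ho /upd /=; split=> [|i iK]; first by rewrite expn_gt0 omega_gt0.
    (* The empty block keeps all earlier points at least [omega] columns before [p]: no row is
       blocked, and state 0 is the right start. *)
    rewrite dig0 nd //; symmetry; apply: rem_eq0 => // j /andP[_ /hO[j' [i' [iK' [-> e] le]]]] _.
    exact: le.
  + by rewrite /upd /= ho.
- move=> c s1 cN [I1 g4]; have [[g0 gp] [g10 g9] gt gx gX] := I1.
  split; first by rewrite /= g4 g10; lia.
  pose inv2 r s := forward_inv ((ec - p - c.+1) * K + (K - r)) s /\ nmem s 4 0 = (p + c)%N.
  apply: wp_seq; apply: (wp_seqs _ _ _ inv2).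
  + rewrite /inv2 subn0; split=> //.
    by have -> : ((ec - p - c.+1) * K + K = (ec - p - c) * K)%N by rewrite addnC -mulSn; congr (_ * _)%N; lia.
  + move=> r s2 rK [I2 k4].
    pose q := ((ec - p - c.+1) * K + (K - r.+1))%N.
    have e1 : crow q = r by rewrite /crow modnMDl modn_small; lia.
    have e2 : ccol q = (p + c)%N by rewrite /ccol divnMDl // divn_small; lia.
    have e3 : ((ec - p - c.+1) * K + (K - r) = q.+1)%N by rewrite /q; lia.
    apply: (@wp_le _ _ _ _ _ _ (lcost (forward_cell r))).
      exact: (leq_bigmax_nat (fun i => lcost (forward_cell i)) _ _ rK).
    apply: wpc_wp; rewrite /inv2 -/q -e2 -{1}e1; apply: forward_cellP; rewrite ?e2 // -?e3 //.
    have : ((ec - p - c.+1).+1 * K <= ec * K)%N by rewrite leq_mul2r; lia.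
    by rewrite mulSn /q; lia.
  + move=> s2 [[[k0 kp] [k10 k9] kt kx kX] k4]; apply: wpc_wp => /=.
    rewrite subnn addn0 in k9 kt kx kX *.
    split; last by rewrite /= /upd /= k4; lia.
    split=> //; split=> //=.
    by rewrite /upd /= kp addn1.
- move=> s1 [[[k0 kp] [k10 k9] [kt ks] kx kX] k4]; rewrite subnn mul0n in ks kX.
  have e : (p + (ec - p) = ec)%N by lia.
  split; first by rewrite /= k4 k10 e addn1 ltnn.
  by split=> //; rewrite ?kp ?k4 // -(addr0 (total _)).
Qed.

End Forward.


(** * Skipping the empty block and detecting the end of the input *)

Definition cost_skip : nat :=
  (lcost (nset 5 (NConst 0)) + 2 * (bcost (blt (nv 5) (nv 0)) +
     lcost (Seq Advance (Seq (incr 4) (incr 5)))).+1).+1.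

Lemma skip_blockP e o s : base s -> pos s = e -> nmem s 4 0 = e -> out s = o ->
  wp skip_block s (cost_skip * omega) (ctx (e + omega) o).
Proof.
move=> hb hp h4 ho.
apply: (@wp_le _ _ _ _ _ _ ((lcost (nset 5 (NConst 0)) + omega.+1 *
    (bcost (blt (nv 5) (nv 0)) + lcost (Seq Advance (Seq (incr 4) (incr 5)))).+1).+1)).
  rewrite /cost_skip; move: (lcost _) (bcost _ + _).+1 omega_gt0; clear; nia.
apply: wp_seq; apply: wpc_wp.
pose inv c s := ctx (e + c) o s /\ nmem s 5 0 = c.
apply: (wp_for _ _ _ inv).
- by rewrite /inv addn0; split=> //; split=> //; exact: base_set_n.
- move=> c s1 cN [[g0 gp go g4] g5]; split.
    by have [h0 _ _ _ _] := g0; rewrite /= h0 g5 addn1.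
  apply: wpc_wp; split; rewrite /= /upd /= ?g4 ?g5 ?addn1 //.
  by split=> //; rewrite ?gp ?addnS.
- move=> s1 [[g0 gp go g4] g5]; have [h0 _ _ _ _] := g0; split=> //.
  by rewrite /= h0 g5 addn1 ltnn.
Qed.

Definition cost_scan : nat :=
  (lcost (Seq (nset 10 (nv 4)) look) +
   (bcost (BAnd (blt (nv 10) (nv 7)) (BLeN (NConst 1) (nv 8))) +
    lcost (Seq (incr 10) look)).+1).+1.

Lemma scanP p o e s : ctx p o s -> nmem s 7 0 = e -> (p <= n)%N -> (0 < p <= e)%N -> (e <= p + L)%N ->
  wp scan s (cost_scan * (minn e n.+1 - p).+1)
    (fun s => ctx p o s /\ nmem s 10 0 = minn e n.+1).
Proof.
move=> hc h7 pn p_e eL; have [hb hp ho h4] := hc.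
set ec := minn e n.+1.
apply: (@wp_le _ _ _ _ _ _ ((lcost (Seq (nset 10 (nv 4)) look) + (ec - p).+1 *
   (bcost (BAnd (blt (nv 10) (nv 7)) (BLeN (NConst 1) (nv 8))) +
    lcost (Seq (incr 10) look)).+1).+1)).
  rewrite /cost_scan; move: (lcost _) (bcost _ + _).+1 (ec - p)%N; clear; nia.
apply: wp_seq; apply: wpc_wp; rewrite /= h4 hp; split; first by rewrite /upd /= leq_addr.
pose inv c s := [/\ ctx p o s, nmem s 7 0 = e, nmem s 10 0 = (p + c)%N &
  nmem s 8 0 = (0 < p + c <= n)%N].
apply: (wp_for _ _ _ inv).
- split=> //; rewrite /= /upd /= ?addn0 //.
- move=> c s1 cN [g0 g7 g10 g8]; split.
    by rewrite /= g10 g7 g8; move: cN; rewrite /ec; lia.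
  apply: wpc_wp; have [_ gp _ _] := g0; rewrite /= /upd /= g10 gp addn1 -addnS.
  split; first by move: cN; rewrite /ec; lia.
  by split.
- move=> s1 [g0 g7 g10 g8]; split; last by split=> //; rewrite g10 /ec; lia.
  by rewrite /= g10 g7 g8 /ec; lia.
Qed.


(** * The search for a light block *)

Section Search.
Variables (B : nat) (o : seq (seq nat)).
Local Notation p := (B * omega).+1.
Local Notation U := (bmax K omega w).

Definition search_inv cnt s := [/\ ctx p o s, nmem s 5 0 = cnt,
  nmem s 10 0 = (p + (M + cnt) * omega)%N &
  (0 < cnt)%N -> exists c, [/\ (M <= c < M + cnt)%N, rmem s 1 0 = U (B + c),
     nmem s 7 0 = (p + c * omega)%N & forall b, (M <= b < M + cnt)%N -> U (B + c) <= U (B + b)]].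

Definition seen col cc r (j i : nat) : bool :=
  ((col <= j < col + cc)%N && (i < K)%N) || ((j == col + cc)%N && (i < r)%N).

Definition block_inv cnt cc r s := let col := (p + (M + cnt) * omega)%N in
  [/\ ctx p o s, nmem s 5 0 = cnt, nmem s 6 0 = cc /\ nmem s 10 0 = (col + cc)%N,
    max_of w (seen col cc r) (rmem s 2 0) &
    (0 < cnt)%N -> exists c, [/\ (M <= c < M + cnt)%N, rmem s 1 0 = U (B + c),
     nmem s 7 0 = (p + c * omega)%N & forall b, (M <= b < M + cnt)%N -> U (B + c) <= U (B + b)]].

Definition cost_search_block : nat :=
  (lcost (Seq (rset 2 RZero) (nset 6 (NConst 0))) + 2 * (bcost (blt (nv 6) (nv 0)) +
    ((K * (\max_(i < K) lcost (search_cell i)).+1).+1 + lcost (Seq (incr 10) (incr 6))).+1).+1).+1.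

Lemma search_cellP cnt cc r s : (cnt < M)%N -> (cc < omega)%N -> (r < K)%N ->
  block_inv cnt cc r s -> wpc (search_cell r) s (block_inv cnt cc r.+1).
Proof.
move=> cM co rK [hc h5 [h6 h10] hmx hx]; have [hb hp ho h4] := hc.
rewrite /= map_neval_const h10 hp; split.
  (* The farthest block read ends less than [2 * M * omega] columns ahead, which fixes the
     look-ahead. *)
  rewrite -addnA leq_add2l; apply: leq_trans L_large.
  have : ((M + cnt).+1 * omega <= 2 * M * omega)%N by rewrite leq_mul2r; lia.
  by rewrite mulSn; lia.
have hmx' := max_of_ext _ _ (seen (p + (M + cnt) * omega) cc r.+1) _ _
  (max_of_step _ _ _ (p + (M + cnt) * omega + cc)%N r hmx).
have {}hmx' : max_of w (seen (p + (M + cnt) * omega) cc r.+1)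
   (Num.max (rmem s 2 0) (w (p + (M + cnt) * omega + cc) r)).
  apply: hmx' => j i; rewrite /seen -orbA; congr (_ || _).
  by rewrite ltnS [in RHS]leq_eqVlt andb_orr orbC.
case: (leP (rmem s 2 0) (w _ r)) hmx' => hle hmx'.
  by split.
by split.
Qed.

Lemma search_blockP cnt s : (cnt < M)%N -> search_inv cnt s ->
  wp search_block s (cost_search_block * omega) (fun s =>
    [/\ ctx p o s, nmem s 5 0 = cnt, nmem s 10 0 = (p + (M + cnt.+1) * omega)%N,
    rmem s 2 0 = U (B + M + cnt) &
    (0 < cnt)%N -> exists c, [/\ (M <= c < M + cnt)%N, rmem s 1 0 = U (B + c),
     nmem s 7 0 = (p + c * omega)%N & forall b, (M <= b < M + cnt)%N -> U (B + c) <= U (B + b)]]).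
Proof.
move=> cM [hc h5 h10 hx].
set A := lcost (Seq (rset 2 RZero) (nset 6 (NConst 0))).
set D := (bcost (blt (nv 6) (nv 0)) +
    ((K * (\max_(i < K) lcost (search_cell i)).+1).+1 + lcost (Seq (incr 10) (incr 6))).+1).+1.
apply: (@wp_le _ _ _ _ _ _ ((A + omega.+1 * D).+1)).
  rewrite /cost_search_block -/A -/D; move: A D omega_gt0; clear; nia.
apply: wp_seq; apply: wpc_wp; rewrite /=.
apply: (wp_for _ _ _ (fun cc => block_inv cnt cc 0)).
- split=> //; first by rewrite /= addn0.
  apply: (max_of_ext _ (fun _ _ => false)); last exact: max_of0.
  by move=> j i; rewrite /seen ltn0 andbF orbF addn0; case: leqP.
- move=> cc s1 co I1; have [[[b0 _ _ _ _] _ _ _] _ [g6 _] _ _] := I1.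
  split; first by rewrite /= g6 b0 addn1.
  apply: wp_seq; apply: (wp_seqs _ _ _ (block_inv cnt cc)) => //.
    move=> r s2 rK I2; apply: (@wp_le _ _ _ _ _ _ (lcost (search_cell r))).
      exact: (leq_bigmax_nat (fun i => lcost (search_cell i)) _ _ rK).
    by apply: wpc_wp; exact: search_cellP.
  move=> s2 [k0 k5 [k6 k10] kmx kx]; apply: wpc_wp; split=> //.
    by rewrite /= /upd /= k6 k10 !addn1 addnS.
  apply: max_of_ext kmx => j i; rewrite /seen; apply/idP/idP; lia.
- move=> s1 [g0 g5 [g6 g10] gmx gx]; have [[b0 _ _ _ _] _ _ _] := g0.
  split; first by rewrite /= g6 b0 addn1 ltnn.
  split=> //; first by rewrite g10 addnS mulSn; lia.
  apply: (max_of_inj w) gmx _; apply: max_of_ext (bmaxP K omega w omega_gt0 _) => j i.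
  by rewrite /block /seen mulSn !mulnDl; apply/idP/idP; lia.
Qed.

Definition cost_search : nat :=
  (lcost (Seq (nset 10 (NAdd (nv 4) (nv 3))) (nset 5 (NConst 0))) +
   2 * (bcost (blt (nv 5) (nv 2)) + (cost_search_block +
     lcost (Seq (If (BAnd (BLeN (NConst 1) (nv 5)) (BNot (BLeR (rv 2) (rv 1)))) Skip
               (Seq (rset 1 (rv 2)) (nset 7 (NSub (nv 10) (nv 0)))))
          (incr 5))).+1).+1).+1.

Lemma searchP s : ctx p o s -> wp search s (cost_search * (M * omega)) (fun s =>
  exists c, [/\ ctx p o s, (M <= c < 2 * M)%N, nmem s 7 0 = (p + c * omega)%N &
    M%:R * U (B + c) <= \sum_(M <= b < 2 * M) U (B + b)]).
Proof.
move=> hc; have [[h0 _ [h2 h3] _ _] hp ho h4] := hc.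
rewrite /cost_search; set A := lcost (Seq (nset _ _) _); set D := bcost _; set E := lcost (Seq (If _ _ _) _).
apply: (@wp_le _ _ _ _ _ _ ((A + M.+1 * (D + (cost_search_block * omega + E).+1).+1).+1)).
  have : ((D + (cost_search_block * omega + E).+1).+1 <= (D + (cost_search_block + E).+1).+1 * omega)%N.
    by move: cost_search_block A D E omega_gt0; clear; nia.
  move: (D + (cost_search_block * omega + E).+1).+1 (D + (cost_search_block + E).+1).+1 => X Y.
  move=> hX; apply: (@leq_trans (A + 2 * M * (Y * omega)).+1).
    have : (M.+1 * X <= 2 * M * (Y * omega))%N by apply: leq_mul => //; lia.
    lia.
  have : (A.+1 <= A.+1 * (M * omega))%N by rewrite leq_pmulr // muln_gt0 M_gt0.
  by move=> h; rewrite mulSn in h *; move: h; clear; nia.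
apply: wp_seq; apply: wpc_wp; rewrite /=.
apply: (wp_for _ _ _ search_inv).
- by split=> //; rewrite /= /upd /= h4 h3 addn0.
- move=> cnt s1 cM I1; have [[[b0 _ [b2 _] _ _] _ _ _] g5 _ _] := I1.
  split; first by rewrite /= g5 b2 addn1.
  apply: wp_seq; apply: wp_mono (search_blockP _ _ cM I1) _ _ => //.
  move=> s2 [k0 k5 k10 kmx kx]; apply: wpc_wp; have [[c0 _ _ _ _] _ _ _] := k0.
  rewrite /= k5; case: ifPn => [/andP[cnt0 hlt]|hge].
    split=> //; first by rewrite /= /upd /= ?k5 addn1.
    move=> _; have [c [hc1 kb k7 kall]] := kx cnt0; exists c; split=> //; first by lia.
    move=> b hb; have [bl|bl] := ltnP b (M + cnt); first by apply: kall; lia.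
    have -> : (b = M + cnt)%N by lia.
    by rewrite addnA -kmx -kb ltW // ltNge.
  split=> //; first by rewrite /= /upd /= ?k5 addn1.
  move=> _; exists (M + cnt)%N; split; [lia|by rewrite /= /upd /= kmx addnA| |].
    by rewrite /= /upd /= k10 c0 addnS mulSn; lia.
  move=> b hb; have [bl|bl] := ltnP b (M + cnt); last first.
    by have -> : (b = M + cnt)%N by lia.
  have cnt0 : (0 < cnt)%N by lia.
  have [c [hc1 kb k7 kall]] := kx cnt0.
  move: hge; rewrite cnt0 /= negbK kmx kb addnA => /le_trans; apply.
  by apply: kall; lia.
- move=> s1 [k0 k5 k10 kx]; have [[_ _ [b2 _] _ _] _ _ _] := k0.
  split; first by rewrite /= k5 b2 addn1 ltnn.
  have [c [hc1 kb k7 kall]] := kx M_gt0; exists c; split=> //; first by lia.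
  have -> : M%:R * U (B + c) = \sum_(M <= b < 2 * M) U (B + c).
    by rewrite sumr_const_nat mulr_natl; congr (_ *+ _); lia.
  by apply: ler_sum_nat => b hb; apply: kall; lia.
Qed.

End Search.


(** * Segments and the main loop, compared with an independent set [O] *)

Variable O : nat -> nat -> bool.
Hypothesis O_indep : indep K omega cfl w O.
Hypothesis w_ge0 : forall j i, 0 <= w j i.
Local Notation U := (bmax K omega w).

Lemma val_segment p ec : (p <= ec)%N ->
  wt K w O p ec <= value K omega cfl w ec ((ec - p) * K) 0.
Proof.
(* Dropping the columns before [p] makes the comparison set start unblocked, in state 0, as the
   replay does. *)
move=> pe; pose O' j i := O j i && (p <= j)%N.
have iO : indep K omega cfl w O'.
  move=> j i /andP[/O_indep[h1 h2 h3 h4] _]; split=> // [j' lt /andP[h _]|i' lt /andP[h _]].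
    exact: h3.
  exact: h4.
have -> : wt K w O p ec = wt K w O' p ec.
  by apply: eq_big_nat => j /andP[pj _]; apply: eq_bigr => i _; rewrite /O' pj andbT.
have {1}-> : (p = ec - (ec - p))%N by lia.
rewrite -(restw_wt K omega w K_gt0 omega_gt0) ?leq_subr //.
apply: (val_upper K omega cfl w K_gt0 omega_gt0 cfl_omega) => //.
  by rewrite leq_mul2r leq_subr orbT.
split=> [|i iK]; first by rewrite expn_gt0 omega_gt0.
rewrite dig0 ndone_mul // subKn //; symmetry; apply: rem_eq0 => // j /andP[_ h1] h2.
by rewrite ltnNge h1 in h2.
Qed.

(* [cut] is the sum of the maxima of the blocks left empty so far. *)
Definition main_inv p s := [/\ ctx p (out s) s, indep K omega cfl w (sel (out s)),
  forall pt, pt \in out s -> exists j i, [/\ (i < K)%N, pt = j :: rw i & (j + omega <= p)%N] &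
  exists B cut, [/\ p = (B * omega).+1 \/ (n < p)%N, 0 <= cut,
    wt K w O 1 p <= total (out s) + K%:R * cut &
    M%:R * cut <= \sum_(0 <= b < B + M) U b]].

Definition cost_search_skip : nat := cost_search + cost_skip + 4.
Definition cost_column : nat := 2 * (cost_scan + cost_backward + cost_forward).

(** [N] is the number of columns solved exactly. The final alternative drives the amortisation:
    either they are enough to pay for the search, or the input is exhausted. *)
Lemma segmentP p s : (0 < p <= n)%N -> main_inv p s ->
  exists N, wp segment s (cost_search_skip * (M * omega) + cost_column * (N * W)) (fun s =>
    main_inv (p + N + omega) s /\ ((p + N <= n.+1)%N /\ ((M * omega <= N)%N \/ (n < p + N)%N))).
Proof.
move=> /andP[p0 pn] [hc hi hpt [B [cut [hp cut0 hO hcut]]]].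
have {}hp : p = (B * omega).+1 by case: hp => //; rewrite ltnNge pn.
set o := out s in hc hi hpt hO.
have W_gt0 : (0 < W)%N by rewrite expn_gt0 omega_gt0.
have Mo : (0 < M * omega)%N by rewrite muln_gt0 M_gt0.
have := searchP B o s; rewrite -hp => /(_ hc)[t1 [s1 [e1 l1 [c [hc1 cM h7 hU]]]]].
set e := (p + c * omega)%N in h7.
set ec := minn e n.+1.
have co : (M * omega <= c * omega)%N by rewrite leq_mul2r; lia.
have pe : (p < ec)%N by rewrite /ec /e; lia.
exists (ec - p)%N.
have pec : (p + (ec - p) = ec)%N by lia.
have cL : (c.+1 * omega <= L)%N.
  by apply: leq_trans L_large; rewrite leq_mul2r; lia.
rewrite mulSn in cL.
have cost : ((cost_search * (M * omega) + cost_scan * (ec - p).+1).+1 +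
    (cost_backward * ((ec - p).+1 * W) + (cost_forward * (ec - p).+1 + cost_skip * omega).+1).+1 < 
    cost_search_skip * (M * omega) + cost_column * ((ec - p) * W))%N.
  rewrite /cost_search_skip /cost_column.
  have o1 : (omega <= M * omega)%N by rewrite leq_pmull.
  (* A segment has at least one column, which accounts for the factor 2 in [cost_column]. *)
  have N1 : ((ec - p).+1 <= 2 * ((ec - p) * W))%N.
    have : (ec - p <= (ec - p) * W)%N by rewrite leq_pmulr.
    by lia.
  have N2 : ((ec - p).+1 * W <= 2 * ((ec - p) * W))%N by rewrite mulnA leq_mul2r; lia.
  have := leq_mul (leqnn cost_scan) N1; have := leq_mul (leqnn cost_backward) N2.
  have := leq_mul (leqnn cost_forward) N1; have := leq_mul (leqnn cost_skip) o1.
  move: cost_search cost_scan cost_backward cost_forward cost_skip => a1 a2 a3 a4 a5.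
  move: (M * omega)%N ((ec - p) * W)%N Mo => x y x0.
  lia.
apply: (wp_le _ _ _ _ _ _ _ _ cost).
apply: wp_seq; apply: wp_seq; exists t1, s1; split=> //.
have hce : (p + c * omega <= p + L)%N by lia.
apply: wp_mono (scanP p o e s1 hc1 h7 pn _ hce) _ _ => //; first by rewrite /e; lia.
move=> s2 [hc2 h10].
apply: wp_seq; apply: wp_mono (backwardP p o ec s2 _ hc2 h10) _ _ => //.
  by rewrite /ec /e; lia.
move=> s3 inv3; apply: wp_seq.
apply: wp_mono (forwardP ec _ p o s3 (ltnW pe) inv3 hi hpt (lexx _)) _ _ => // s4.
move=> [b4 p4 k4 [i4 w4] tot4].
apply: wp_mono (skip_blockP ec (out s4) s4 b4 p4 k4 erefl) _ _ => // s5 c5.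
have o5 : out s5 = out s4 by case: c5.
rewrite pec; split; last by rewrite /ec; split; [|case: leqP => h; [left|right]]; lia.
split; rewrite ?o5 //.
  move=> pt /w4[j [i [iK -> lt]]]; exists j, i; split=> //.
  by rewrite leq_add2r ltnW // (leq_trans lt) ?leq_subr.
exists (B + c).+1, (cut + U (B + c)); split.
- have [le|lt] := leqP e n.+1; [left|right]; rewrite /ec.
    by rewrite (minn_idPl le) /e hp mulSn mulnDl; lia.
  by move: lt; lia.
- by rewrite addr_ge0 // bmax_ge0.
- rewrite (@wt_cat _ K w O 1 p); last by rewrite p0; lia.
  rewrite (@wt_cat _ K w O p ec); last by lia.
  have hwin : wt K w O ec (ec + omega) <= K%:R * U (B + c).
    apply: wt_window O_indep _ _ => //; first exact: bmax_ge0.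
    move=> j i hj iK; have [_ hb _] := bmaxP K omega w omega_gt0 (B + c).
    (* A positive weight puts [j] at most [n], so [ec] is the cut [e] and the window is block
       [B + c]. If the input ended earlier, the window contains only zeros. *)
    case: (ltP 0 (w j i)) => [/w_supp hjn|h]; last exact: le_trans h (bmax_ge0 _ _ _ _ _).
    have ee : ec = e by rewrite /ec; lia.
    by apply: hb; rewrite /block iK andbT; move: hj; rewrite ee /e hp mulSn mulnDl; lia.
  have hv := val_segment p ec (ltnW pe).
  move: hO hwin hv tot4; rewrite mulrDr; move: (wt _ _ _ _ _) (wt _ _ _ _ _) (wt _ _ _ _ _) => x y z.
  by move: (total _) (total _) (K%:R * _) (K%:R * _) (value _ _ _ _ _ _ _) => a b c' d v; lra.
(* The old sum stops at [B + M], where the new candidates begin. These end at [B + 2 * M], which is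
   at most [(B + c).+1 + M] because [c >= M]. *)
- rewrite mulrDr; apply: le_trans (lerD hcut hU) _.
  have -> : \sum_(M <= b < 2 * M) U (B + b) = \sum_(B + M <= b < B + 2 * M) U b.
    by rewrite (addnC B M) big_addn addKn; apply: eq_bigr => b _; rewrite addnC.
  rewrite -big_cat_nat //=; last by lia.
  rewrite [leRHS](@big_cat_nat _ _ _ (B + 2 * M)) //=; last by lia.
  by rewrite lerDl; apply: sumr_ge0 => b _; exact: bmax_ge0.
Qed.

Definition cost_overhead : nat :=
  cost_search_skip + bcost (BLeN (NConst 1) (nv 8)) + lcost look + 3.

(** Every segment after which columns remain has [N >= M * omega], so its search is charged to its
    own columns; the separate term [M * omega] pays for the last search. *)
Lemma main_loopP p s : (0 < p)%N -> main_inv p s -> nmem s 8 0 = (0 < p <= n)%N ->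
  wp main_loop s (cost_overhead * (M * omega) +
      (cost_overhead + cost_column) * ((n.+1 - p) * W)) (fun s => exists2 p', (n < p')%N & main_inv p' s).
Proof.
have [k] := ubnP (n.+1 - p); elim: k p s => // k IH p s hk p0 I h8.
have W_gt0 : (0 < W)%N by rewrite expn_gt0 omega_gt0.
have Mo : (0 < M * omega)%N by rewrite muln_gt0 M_gt0.
have stop s' p' : (n < p')%N -> main_inv p' s' -> nmem s' 8 0 = (0 < p' <= n)%N ->
    wp main_loop s' (bcost (BLeN (NConst 1) (nv 8))).+1 (fun s => exists2 p', (n < p')%N & main_inv p' s).
  move=> np I' h8'; apply: wp_while_end; last by exists p'.
  by rewrite /= h8'; lia.
have [np|pn] := ltnP n p.
  apply: wp_le (stop s p np I h8); rewrite /cost_overhead.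
  move: (bcost _) (lcost _) cost_search_skip Mo; clear; nia.
have [|N [t1 [s1 [e1 l1 [I1 [h1 h2]]]]]] := segmentP p s _ I; first by rewrite p0.
set A := bcost (BLeN (NConst 1) (nv 8)).
set r := (if (n < p + N + omega)%N then A.+1 else
  cost_overhead * (M * omega) + (cost_overhead + cost_column) * ((n.+1 - (p + N + omega)) * W))%N.
apply: (@wp_le _ _ _ _ _ _
  (A + (cost_search_skip * (M * omega) + cost_column * (N * W) + lcost look).+1 + r).+1).
  have NW : (N * W <= (n.+1 - p) * W)%N by rewrite leq_mul2r; lia.
  have oh : (cost_search_skip * (M * omega) + A + lcost look + 3 <= cost_overhead * (M * omega))%N.
    rewrite /cost_overhead -/A; move: Mo; clear; move: cost_search_skip A (lcost look); nia.
  rewrite /r; case: (ltnP n (p + N + omega)) => hn.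
    have p1 : (1 <= (n.+1 - p) * W)%N by rewrite muln_gt0 W_gt0 andbT; lia.
    have c1 := leq_mul (leqnn cost_column) NW.
    have c2 : (A.+1 <= cost_overhead * ((n.+1 - p) * W))%N.
      apply: leq_trans (leq_mul (leqnn cost_overhead) p1).
      by rewrite /cost_overhead -/A; lia.
    rewrite mulnDl; lia.
  have {}h2 : (M * omega <= N)%N by case: h2 => //; lia.
  have MN : (M * omega <= N * W)%N by apply: leq_trans h2 _; rewrite leq_pmulr.
  have sp : (N * W + (n.+1 - (p + N + omega)) * W <= (n.+1 - p) * W)%N.
    by rewrite -mulnDl leq_mul2r; lia.
  have c1 := leq_mul (leqnn (cost_overhead + cost_column)) sp.
  have c2 := leq_mul (leqnn cost_overhead) MN.
  move: c1 c2 oh; rewrite !mulnDr !mulnDl; lia.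
apply: wp_while_step; first by rewrite /= h8 p0 pn.
apply: wp_seq; exists t1, s1; split=> //; apply: wpc_wp.
have [[b1 p1 _ k1] i1 w1 x1] := I1.
rewrite /= k1 p1; split; first exact: leq_addr.
set s2 := set_n _ 8 _ _.
have I2 : main_inv (p + N + omega) s2 by split=> //; split=> //; exact: base_set_n.
have g8 : nmem s2 8 0 = (0 < p + N + omega <= n)%N by [].
rewrite /r; case: (ltnP n (p + N + omega)) => hn; first exact: stop I2 g8.
apply: IH => //; lia.
Qed.


(** * Setup: parameters, powers and digit tables *)

Variables (eps : R) (m : nat).
Hypothesis m_large : 1 <= m%:R * eps.
Hypothesis m_least : forall j, (j < m)%N -> j%:R * eps < 1.
Hypothesis n_gt0 : (0 < n)%N.
Hypothesis M_def : M = (2 * K * m.+1)%N.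

Definition fresh s := [/\ pos s = 1, out s = [::], nmem s 0 0 = omega & forall x, rmem s 4 x = 0].

Definition cost_count : nat := (bcost (BNot (BLeR ROne (rv 1))) +
  lcost (Seq (rset 1 (RAdd (rv 1) (rv 0))) (incr 2))).+1.

Lemma countP : wp count (init eps omega) (cost_count * m.+1)
  (fun s => fresh s /\ nmem s 2 0 = m).
Proof.
rewrite mulnC.
pose inv c s := [/\ fresh s, nmem s 2 0 = c, rmem s 0 0 = eps & rmem s 1 0 = c%:R * eps].
apply: (wp_for _ _ _ inv).
- by split; rewrite /= /upd /= ?mul0r.
- move=> c s cm [[h1 h2 h3 h4] g2 ge g1]; split; first by rewrite /= g1 -ltNge m_least.
  by apply: wpc_wp; split; rewrite /= /upd //= ?g2 ?addn1 // ge g1 -natr1 mulrDl mul1r.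
- by move=> s [h g2 ge g1]; split=> //=; rewrite g1 m_large.
Qed.

Definition cost_multiply : nat :=
  (lcost (Seq (nset 2 (nscale (2 * K) (NAdd (nv 2) (NConst 1)))) (Seq (nset 3 (NConst 0)) (nset 6 (NConst 0))))
   + 2 * (bcost (blt (nv 6) (nv 0)) + lcost (Seq (nset 3 (NAdd (nv 3) (nv 2))) (incr 6))).+1).+1.

Lemma neval_nscale s c e : neval s (nscale c e) = (c * neval s e)%N.
Proof. by rewrite /nscale; elim: c => //= c ->; rewrite mulSn. Qed.

Lemma multiplyP s : fresh s -> nmem s 2 0 = m -> wp multiply s (cost_multiply * omega)
  (fun s => [/\ fresh s, nmem s 2 0 = M & nmem s 3 0 = (M * omega)%N]).
Proof.
move=> [h1 h2 h3 h4] g2; rewrite /cost_multiply /multiply.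
set c1 := Seq (nset 2 _) _; set c2 := Seq (nset 3 (NAdd _ _)) _.
apply: (@wp_le _ _ _ _ _ _ ((lcost c1 + omega.+1 * (bcost (blt (nv 6) (nv 0)) + lcost c2).+1).+1)).
  move: (lcost _) (bcost _ + _).+1 omega_gt0; clear; nia.
apply: wp_seq; apply: wpc_wp; rewrite /c1; cbn [wpc nset]; rewrite neval_nscale.
pose inv x s := [/\ fresh s, nmem s 2 0 = M, nmem s 3 0 = (M * x)%N & nmem s 6 0 = x].
apply: (wp_for _ _ _ inv).
- by split; rewrite /= /upd /= ?muln0 // g2 addn1 M_def.
- move=> x s1 xo [[k1 k2 k3 k4] f2 f3 f6]; split; first by rewrite /= f6 k3 addn1.
  by apply: wpc_wp; split; rewrite /= /upd /= ?f2 ?f3 ?f6 ?addn1 // mulnS addnC.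
- move=> s1 [k f2 f3 f6]; have [_ _ k3 _] := k; split=> //.
  by rewrite /= f6 k3 addn1 ltnn.
Qed.

Definition scaled s := [/\ fresh s, nmem s 2 0 = M & nmem s 3 0 = (M * omega)%N].

Definition cost_power : nat := \max_(i < K)
  (lcost (Seq (NSet 1 (NConst i.+1) (NConst 0)) (nset 6 (NConst 0))) +
   2 * (bcost (blt (nv 6) (nv 0)) +
     lcost (Seq (NSet 1 (NConst i.+1) (NAdd (npow i.+1) (npow i))) (incr 6))).+1).+1.

Lemma powerP i s : (i < K)%N -> scaled s ->
  (forall r, (r <= i)%N -> nmem s 1 r = (omega ^ r)%N) ->
  wp (power i) s (cost_power * omega) (fun s => scaled s /\
    forall r, (r <= i.+1)%N -> nmem s 1 r = (omega ^ r)%N).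
Proof.
move=> iK [[h1 h2 h3 h4] g2 g3] g1.
set A := lcost (Seq (NSet 1 (NConst i.+1) (NConst 0)) (nset 6 (NConst 0))).
set D := (bcost (blt (nv 6) (nv 0)) +
     lcost (Seq (NSet 1 (NConst i.+1) (NAdd (npow i.+1) (npow i))) (incr 6))).+1.
apply: (@wp_le _ _ _ _ _ _ ((A + omega.+1 * D).+1)).
  apply: (@leq_trans ((A + 2 * D).+1 * omega)); first by move: A D omega_gt0; clear; nia.
  rewrite leq_mul2r; apply/orP; right.
  exact: (leq_bigmax_nat (fun i => (lcost (Seq (NSet 1 (NConst i.+1) (NConst 0)) (nset 6 (NConst 0))) +
   2 * (bcost (blt (nv 6) (nv 0)) +
     lcost (Seq (NSet 1 (NConst i.+1) (NAdd (npow i.+1) (npow i))) (incr 6))).+1).+1) _ _ iK).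
apply: wp_seq; apply: wpc_wp; rewrite /=.
pose inv x s := [/\ scaled s, nmem s 6 0 = x, nmem s 1 i.+1 = (x * omega ^ i)%N &
  forall r, (r <= i)%N -> nmem s 1 r = (omega ^ r)%N].
apply: (wp_for _ _ _ inv).
- split=> //; first by rewrite /= /upd /= eqxx.
  move=> r ri; rewrite /= /upd /= ltn_eqF ?ltnS //; exact: g1.
- move=> x s1 xo [[[k1 k2 k3 k4] f2 f3] f6 f1 fr]; split; first by rewrite /= f6 k3 addn1.
  apply: wpc_wp; split; rewrite //= ?/upd /= ?f6 ?addn1 //.
    by rewrite eqxx f1 fr // mulSn addnC.
  by move=> r ri; rewrite ltn_eqF ?ltnS // fr.
- move=> s1 [k f6 f1 fr]; have [[_ _ k3 _] _ _] := k.
  split; first by rewrite /= f6 k3 addn1 ltnn.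
  by split=> // r; rewrite leq_eqVlt ltnS => /orP[/eqP->|]; [rewrite f1 expnS|exact: fr].
Qed.

Definition powered s := scaled s /\ forall i, (i <= K)%N -> nmem s 1 i = (omega ^ i)%N.

Lemma powersP s : scaled s ->
  wp (Seq (NSet 1 (NConst 0) (NConst 1)) (seqs power K)) s (((K * cost_power.+1).+1 + 4) * omega) powered.
Proof.
move=> [[h1 h2 h3 h4] g2 g3].
apply: (@wp_le _ _ _ _ _ _ ((3 + (K * (cost_power * omega).+1).+1).+1)).
  by move: cost_power omega_gt0; clear; nia.
apply: wp_seq; apply: (@wpc_wp _ _ _ _ (NSet 1 (NConst 0) (NConst 1))) => /=.
apply: (wp_seqs _ _ _ (fun i s => scaled s /\ forall r, (r <= i)%N -> nmem s 1 r = (omega ^ r)%N)) => //.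
- by split=> // r; rewrite leqn0 => /eqP->.
- by move=> i s1 iK [k1 k2]; exact: powerP.
Qed.

Definition cost_digits : nat := \max_(i < K)
  (lcost (nset 6 (NConst 0)) + 2 * (bcost (blt (nv 6) (npow K)) + lcost (digits_step i)).+1).+1.

Lemma adig_eq i j : (adig i == adig j) = (i == j).
Proof. by []. Qed.

Lemma digitsP i s : (i < K)%N -> powered s ->
  (forall r x, (r < i)%N -> (x < W)%N -> nmem s (adig r) x = dig omega r x) ->
  wp (digits i) s (cost_digits * W) (fun s => powered s /\
    forall r x, (r < i.+1)%N -> (x < W)%N -> nmem s (adig r) x = dig omega r x).
Proof.
move=> iK [[[h1 h2 h3 h4] g2 g3] g1] gd.
have W_gt0 : (0 < W)%N by rewrite expn_gt0 omega_gt0.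
set D := (bcost (blt (nv 6) (npow K)) + lcost (digits_step i)).+1.
apply: (@wp_le _ _ _ _ _ _ ((lcost (nset 6 (NConst 0)) + W.+1 * D).+1)).
  apply: (@leq_trans ((lcost (nset 6 (NConst 0)) + 2 * D).+1 * W)).
    by move: (lcost _) D W_gt0; clear; nia.
  rewrite leq_mul2r; apply/orP; right.
  exact: (leq_bigmax_nat (fun i => (lcost (nset 6 (NConst 0)) +
     2 * (bcost (blt (nv 6) (npow K)) + lcost (digits_step i)).+1).+1) _ _ iK).
apply: wp_seq; apply: wpc_wp; rewrite /=.
pose inv x s := [/\ powered s, nmem s 6 0 = x,
  forall y, (y < x)%N -> nmem s (adig i) y = dig omega i y &
  forall r x, (r < i)%N -> (x < W)%N -> nmem s (adig r) x = dig omega r x].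
have next x s1 v z : inv x s1 -> v = dig omega i x -> z = x.+1 ->
    inv x.+1 (set_n (set_n s1 (adig i) x v) 6 0 z).
  move=> [[[[k1 k2 k3 k4] f2 f3] f1] f6 fx fr] ev ->; split=> //.
  - move=> y; rewrite ltnS leq_eqVlt /= /upd /= eqxx /= => /orP[/eqP->|lt]; first by rewrite eqxx.
    by rewrite ltn_eqF // fx.
  - move=> r y ri yW; rewrite /= /upd /=.
    have -> : (r.+4.+4.+3 == i.+4.+4.+3) = false by rewrite (adig_eq r i) ltn_eqF.
    exact: fr.
apply: (wp_for _ _ _ inv).
- by split.
- move=> x s1 xW I; have [[[[k1 k2 k3 k4] f2 f3] f1] f6 fx fr] := I.
  split; first by rewrite /= f6 f1 // addn1.
  have le : (omega ^ i <= W)%N by rewrite leq_pexp2l // ltnW.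
  apply: (wpc_wp _ _ _ (digits_step i)); rewrite /= f6 f1 ?(ltnW iK) // k3 !addn1.
  have rec := dig_rec omega omega_gt0 i x.
  case: (ltnP x (omega ^ i)) rec => hx rec; first exact: next (f_equal S f6).
  have ed : nmem s1 (adig i) (x - omega ^ i) = dig omega i (x - omega ^ i).
    by rewrite fx // ltn_subrL expn_gt0 omega_gt0 /=; apply: leq_trans hx; rewrite expn_gt0 omega_gt0.
  rewrite ed; case: ltnP rec => hd rec; exact: next (f_equal S f6).
- move=> s1 [k f6 fx fr]; have [_ f1] := k; split; first by rewrite /= f6 f1 // addn1 ltnn.
  split=> // r x; rewrite ltnS leq_eqVlt => /orP[/eqP->|]; [exact: fx|exact: fr].
Qed.

Definition cost_setup : nat :=
  cost_count + cost_multiply + ((K * cost_power.+1).+1 + 4) + (K * cost_digits.+1).+1 + 4.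

Lemma setupP : wp setup (init eps omega) (cost_setup * (m.+1 * W))
  (fun s => [/\ base s, pos s = 1 & out s = [::]]).
Proof.
have W_gt0 : (0 < W)%N by rewrite expn_gt0 omega_gt0.
have oW : (omega <= W)%N by rewrite -{1}[omega]expn1 leq_pexp2l.
apply: (@wp_le _ _ _ _ _ _ (((cost_count * m.+1 + cost_multiply * omega).+1 +
    (((K * cost_power.+1).+1 + 4) * omega)).+1 + (K * (cost_digits * W).+1).+1).+1).
  rewrite /cost_setup.
  have h1 : (m.+1 <= m.+1 * W)%N by rewrite leq_pmulr.
  have h2 : (W <= m.+1 * W)%N by rewrite leq_pmull.
  have h3 : (K * (cost_digits * W).+1 <= K * cost_digits.+1 * W)%N.
    by rewrite -mulnA leq_mul2l mulSn -add1n leq_add2r W_gt0 orbT.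
  have c1 := leq_mul (leqnn cost_count) h1.
  have c2 := leq_mul (leqnn cost_multiply) (leq_trans oW h2).
  have c3 := leq_mul (leqnn ((K * cost_power.+1).+1 + 4)) (leq_trans oW h2).
  have c4 := leq_mul (leqnn (K * cost_digits.+1)) h2.
  have X1 : (0 < m.+1 * W)%N by rewrite muln_gt0.
  have E a1 a2 a3 a4 b1 b2 b3 b4 X : (a1 <= b1 * X)%N -> (a2 <= b2 * X)%N -> (a3 <= b3 * X)%N ->
      (a4 <= b4 * X)%N -> (0 < X)%N ->
      ((((a1 + a2).+1 + a3).+1 + a4.+1).+1 <= (b1 + b2 + b3 + b4.+1 + 4) * X)%N.
    by clear; nia.
  exact: E c1 c2 c3 (leq_trans h3 c4) X1.
apply: wp_seq; apply: wp_seq; apply: wp_seq.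
apply: wp_mono countP _ _ => // s1 [f1 g1].
apply: wp_mono (multiplyP s1 f1 g1) _ _ => // s2 sc2.
apply: wp_mono (powersP s2 sc2) _ _ => // s3 p3.
apply: (wp_seqs _ _ _ (fun i s => powered s /\
    forall r x, (r < i)%N -> (x < W)%N -> nmem s (adig r) x = dig omega r x)) => //.
- by move=> i s4 iK [k1 k2]; exact: digitsP.
- move=> s4 [[[[k1 k2 k3 k4] f2 f3] f5] fd]; split=> //; split=> // x _; exact: k4.
Qed.

Definition cost_program : nat :=
  cost_setup + lcost (Seq (nset 4 (NConst 1)) look) + 2 * K * cost_overhead +
  (cost_overhead + cost_column) + 3.

Lemma programP : wp program (init eps omega) (cost_program * (m.+1 * n * W))
  (fun s => exists2 p, (n < p)%N & main_inv p s).
Proof.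
have W_gt0 : (0 < W)%N by rewrite expn_gt0 omega_gt0.
have oW : (omega <= W)%N by rewrite -{1}[omega]expn1 leq_pexp2l.
apply: (@wp_le _ _ _ _ _ _ ((cost_setup * (m.+1 * W) +
   (lcost (Seq (nset 4 (NConst 1)) look) + (cost_overhead * (M * omega) +
      (cost_overhead + cost_column) * ((n.+1 - 1) * W))).+1).+1)).
  have h1 : (m.+1 * W <= m.+1 * n * W)%N by rewrite leq_mul2r leq_pmulr ?orbT.
  have h2 : (m.+1 * omega <= m.+1 * n * W)%N.
    by apply: leq_trans h1; rewrite leq_mul2l oW orbT.
  have h3 : (n * W <= m.+1 * n * W)%N by rewrite -mulnA leq_pmull.
  have h4 : (0 < m.+1 * n * W)%N by rewrite !muln_gt0 n_gt0 W_gt0.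
  have c1 := leq_mul (leqnn cost_setup) h1.
  have c2 := leq_mul (leqnn (2 * K * cost_overhead)) h2.
  have c3 := leq_mul (leqnn (cost_overhead + cost_column)) h3.
  rewrite subn1 /= M_def /cost_program.
  have -> : (cost_overhead * (2 * K * m.+1 * omega) = 2 * K * cost_overhead * (m.+1 * omega))%N by lia.
  have E a1 a2 a3 l b1 b2 b3 X : (a1 <= b1 * X)%N -> (a2 <= b2 * X)%N -> (a3 <= b3 * X)%N ->
      (0 < X)%N -> ((a1 + (l + (a2 + a3)).+1).+1 <= (b1 + l + b2 + b3 + 3) * X)%N.
    by clear; nia.
  exact: E c1 c2 c3 h4.
apply: wp_seq; apply: wp_mono setupP _ _ => // s [hb hp ho].
apply: wp_seq; apply: wpc_wp; rewrite /= /upd /= hp; split; first exact: leq_addr.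
set s1 := set_n _ _ _ _.
have hb1 : base s1 by apply: base_set_n => //; exact: base_set_n.
apply: main_loopP => //; split; rewrite ?[out s1]ho //.
- by move=> j i; rewrite /sel in_nil andbF.
- exists 0%N, 0; split=> //; first by left.
  + by rewrite /wt big_geq // mulr0 addr0; exact: wt_ge0.
  + by rewrite mulr0; apply: sumr_ge0 => b _; exact: bmax_ge0.
Qed.

End Semantics.
End Program.
(** * Networks as weighted cells *)

Section Grid.
Variable k : nat.

(** The rows fill all of {1..k}^l, because the side lengths of the narrow cube are not given to the
    program. Cells outside that cube have weight 0 and are never selected. *)
Fixpoint grid (l : nat) : seq (seq nat) :=
  if l is l'.+1 then [seq c :: r | c <- iota 1 k, r <- grid l'] else [:: [::]].

Lemma size_grid l : size (grid l) = (k ^ l)%N.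
Proof. by elim: l => //= l IH; rewrite size_allpairs size_iota IH expnS. Qed.

Lemma grid_uniq l : uniq (grid l).
Proof.
elim: l => //= l IH; apply: allpairs_uniq => //; first exact: iota_uniq.
by move=> [c r] [c' r'] _ _ /= [-> ->].
Qed.

Lemma mem_grid l r : (r \in grid l) = (size r == l) && all (fun c => 0 < c <= k)%N r.
Proof.
elim: l r => [|l IH] r; first by case: r.
apply/allpairsP/idP => [[[c r'] /= []]|].
  rewrite mem_iota IH => hc /andP[/eqP hs ha] ->; rewrite /= hs eqxx ha andbT /=.
  by move: hc; lia.
case: r => //= c r /andP[/eqP[hs] /andP[hc ha]]; exists (c, r); split=> //=.
  by rewrite mem_iota; lia.
by rewrite IH hs eqxx.
Qed.

Definition row_pt l i : seq nat := nth [::] (grid l) i.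

Lemma row_pt_inj l i i' : (i < k ^ l)%N -> (i' < k ^ l)%N ->
  row_pt l i = row_pt l i' -> i = i'.
Proof.
rewrite -size_grid => hi hi' /eqP; rewrite /row_pt nth_uniq ?grid_uniq //.
by move/eqP.
Qed.

Definition rdiff (l : nat) (r r' : seq nat) : nat := \sum_(t < l) (nth 0%N r t != nth 0%N r' t).
Definition rdist (l : nat) (r r' : seq nat) : nat :=
  \sum_(t < l) `|(nth 0%N r t)%:Z - (nth 0%N r' t)%:Z|%N.

Definition adjacent_rows l i i' : bool := rdiff l (row_pt l i) (row_pt l i') == 1%N.
Definition row_dist l i i' : nat := rdist l (row_pt l i) (row_pt l i').

Lemma rdist_gt0 l r r' : (0 < rdiff l r r')%N -> (0 < rdist l r r')%N.
Proof.
rewrite !lt0n; apply: contra; rewrite /rdist /rdiff !sum_nat_eq0 => /forallP h.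
apply/forallP => t; have := h t; rewrite absz_eq0 subr_eq0 eqz_nat => /eqP ->.
by rewrite eqxx.
Qed.

Lemma rdiff_eq0 l r r' : size r = l -> size r' = l -> (rdiff l r r' == 0%N) = (r == r').
Proof.
move=> hs hs'; rewrite /rdiff sum_nat_eq0; apply/forallP/eqP => [h|-> t]; last by rewrite eqxx.
apply: (@eq_from_nth _ 0%N); rewrite ?hs // => t ht.
by have := h (Ordinal ht); rewrite eqb0 negbK => /eqP.
Qed.

Lemma rdist_id l r : rdist l r r = 0%N.
Proof. by apply: big1 => t _; rewrite subrr. Qed.

End Grid.

Section Network.
Context {R : realType}.
Variables (l k n omega : nat) (G : wgraph R) (f : G -> l.+1.-tuple nat).
Hypothesis omega_gt0 : (0 < omega)%N.
Hypothesis narrow : narrow_los n k omega f.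
Local Notation K := (k ^ l)%N.
Local Notation rw := (row_pt k l).
Local Notation w := (cellw rw (cell_weight f)).
Local Notation cfl := (cflict (adjacent_rows k l) (row_dist k l) omega).
Implicit Types (u v : G) (A : nat -> nat -> bool).

Definition vcol v : nat := head 0%N (f v).
Definition vrow v : nat := index (behead (f v)) (grid k l).

Lemma f_cell v : [/\ (0 < vcol v <= n)%N, (vrow v < K)%N & val (f v) = vcol v :: rw (vrow v)].
Proof.
have [_ _ [x [hx hb]] _] := narrow; move: (hb v) (size_tuple (f v)).
rewrite /vcol /vrow /box /row_pt; case: (f v) => s /= _.
case: s => //= c r /andP[hc hr] [hs].
have hg : r \in grid k l.
  rewrite mem_grid hs eqxx /=; move: hx hr.
  move: (tval x) => x'; elim: x' r {hs hb} => [|m x' IH] [|c' r'] //= /andP[hm hx] /andP[hc' hr].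
  by rewrite (IH _ hx hr) andbT; lia.
by split=> //; rewrite ?nth_index // -size_grid index_mem.
Qed.

Lemma cell_inj u v : vcol u = vcol v -> vrow u = vrow v -> u = v.
Proof.
have [f_inj _ _ _] := narrow; move=> hc hr; apply: f_inj; apply: val_inj.
by have [_ _ ->] := f_cell u; have [_ _ ->] := f_cell v; rewrite hc hr.
Qed.

Lemma cell_eq v j i : (i < K)%N -> (val (f v) == j :: rw i) = (vcol v == j) && (vrow v == i).
Proof.
move=> iK; have [_ vK ->] := f_cell v; rewrite eqseq_cons; congr (_ && _).
by apply/eqP/eqP => [|->//]; exact: row_pt_inj.
Qed.

Lemma w_ge0 j i : 0 <= w j i.
Proof. by apply: sumr_ge0 => v _; exact/ltW/weight_gt0. Qed.

Lemma w_gt0P j i : 0 < w j i -> exists v, val (f v) = j :: rw i.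
Proof.
move=> h; case: (pickP (fun v => val (f v) == j :: rw i)) => [v /eqP|h0]; first by exists v.
by move: h; rewrite /cellw /cell_weight big_pred0 // ltxx.
Qed.

Lemma w_supp j i : 0 < w j i -> (0 < j <= n)%N.
Proof. by case/w_gt0P => v; have [hc _ ->] := f_cell v => -[<-]. Qed.

Lemma w_vertex v : w (vcol v) (vrow v) = weight v.
Proof.
have [_ vK _] := f_cell v; rewrite /cellw /cell_weight.
rewrite (big_pred1 v) // => u; rewrite cell_eq //.
apply/andP/eqP => [[/eqP h1 /eqP h2]|->//]; exact: cell_inj.
Qed.

Lemma edge_cells u v : edge u v =
  ((vcol u != vcol v) + rdiff l (rw (vrow u)) (rw (vrow v)) == 1)%N &&
  (`|(vcol u)%:Z - (vcol v)%:Z| + row_dist k l (vrow u) (vrow v) < omega)%N.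
Proof.
have [_ _ _ ->] := narrow; have [_ _ eu] := f_cell u; have [_ _ ev] := f_cell v.
have tu (t : 'I_l) : tnth (f u) (lift ord0 t) = nth 0%N (rw (vrow u)) t.
  by rewrite (tnth_nth 0%N) eu.
have tv (t : 'I_l) : tnth (f v) (lift ord0 t) = nth 0%N (rw (vrow v)) t.
  by rewrite (tnth_nth 0%N) ev.
have u0 : tnth (f u) ord0 = vcol u by rewrite (tnth_nth 0%N) eu.
have v0 : tnth (f v) ord0 = vcol v by rewrite (tnth_nth 0%N) ev.
congr (_ && _).
  rewrite /line_of_sight -sum1dep_card big_mkcond big_ord_recl u0 v0; congr (_ == _).
  congr (_ + _)%N.
  by apply: eq_bigr => t _; rewrite tu tv; case: (_ != _).
rewrite /manhattan big_ord_recl u0 v0; congr (_ + _ < _)%N.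
by apply: eq_bigr => t _; rewrite tu tv.
Qed.

Lemma size_rw i : (i < K)%N -> size (rw i) = l.
Proof.
move=> iK; have : rw i \in grid k l by rewrite mem_nth // size_grid.
by rewrite mem_grid => /andP[/eqP].
Qed.

(** Exactly one coordinate differs: if it is the first, the row parts agree; otherwise the columns
    agree and the whole distance is that of the rows. *)
Lemma edgeP u v : edge u v <->
  (vrow u = vrow v /\ (0 < `|(vcol u)%:Z - (vcol v)%:Z| < omega)%N) \/
  (vcol u = vcol v /\ cfl (vrow u) (vrow v)).
Proof.
have [_ uK _] := f_cell u; have [_ vK _] := f_cell v.
rewrite edge_cells; split.
  case/andP; case: (eqVneq (vcol u) (vcol v)) => [e|ne] /=.
    rewrite e subrr add0n absz0 add0n => h1 h2; right; split=> //.
    by rewrite /cflict /adjacent_rows h1.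
  rewrite add1n eqSS rdiff_eq0 ?size_rw // => /eqP/row_pt_inj -> //.
  by rewrite /row_dist rdist_id addn0 => h; left; split=> //; lia.
case=> [[e h]|[e /andP[h1 h2]]].
  have -> : vcol u != vcol v by apply/eqP => ec; move: h; rewrite ec subrr.
  rewrite /row_dist e rdist_id addn0 add1n eqSS rdiff_eq0 ?size_rw // eqxx /=.
  by case/andP: h.
by rewrite e eqxx subrr absz0 /= !add0n; apply/andP.
Qed.

Definition cell_set A : {set G} := [set v | A (vcol v) (vrow v)].

Definition set_cells (S : {set G}) (j i : nat) : bool :=
  [exists v in S, (vcol v == j) && (vrow v == i)].

Lemma set_cellsK S : cell_set (set_cells S) = S.
Proof.
apply/setP => v; rewrite inE; apply/existsP/idP => [[u /andP[uS /andP[/eqP h1 /eqP h2]]]|vS].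
  by rewrite -(cell_inj u v).
by exists v; rewrite vS !eqxx.
Qed.

Lemma weight_cell_set A : set_weight (cell_set A) = wt K w A 1 n.+1.
Proof.
rewrite /wt /colw /set_weight big_mkcond /=.
(* A triple sum over columns, rows and vertices: summed over cells first, each vertex counts once;
   summed over vertices first, each cell gives its weight [w]. *)
transitivity (\sum_(1 <= j < n.+1) \sum_(0 <= i < K) \sum_(v : G)
    if (j == vcol v) && (i == vrow v) then (if A (vcol v) (vrow v) then weight v else 0) else 0).
  under [RHS]eq_bigr do rewrite exchange_big /=.
  rewrite [RHS]exchange_big /=; apply: eq_bigr => v _; have [hc hr _] := f_cell v.
  rewrite inE.
  have E j : \sum_(0 <= i < K) (if (j == vcol v) && (i == vrow v) then
      (if A (vcol v) (vrow v) then weight v else 0) else 0) =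
      if j == vcol v then (if A (vcol v) (vrow v) then weight v else 0) else 0.
    case: (j == vcol v) => /=; last by rewrite big1.
    by rewrite -big_mkcond /= big_nat1_eq hr.
  under eq_bigr do rewrite E.
  by rewrite -big_mkcond /= big_nat1_eq ltnS hc.
apply: eq_bigr => j _; apply: eq_big_nat => i /andP[_ iK].
transitivity (\sum_(v | (vcol v == j) && (vrow v == i)) if A j i then weight v else 0).
  rewrite [RHS]big_mkcond /=; apply: eq_bigr => v _.
  rewrite [j == _]eq_sym [i == _]eq_sym; case: ifP => // /andP[/eqP-> /eqP->] //.
case: (A j i); last by rewrite big1.
by apply: eq_bigl => v; rewrite cell_eq.
Qed.

Lemma indep_cell_set A : indep K omega cfl w A -> independent (cell_set A).
Proof.
move=> iA; apply/forallP => u; apply/implyP; rewrite inE => hu.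
apply/forallP => v; apply/implyP; rewrite inE => hv; apply/negP => he.
(* [indep] excludes a conflict at the later cell only, so the edge is needed in both
   orientations. *)
have he' : edge v u by rewrite edge_sym.
have [_ _ hu1 hu2] := iA _ _ hu; have [_ _ hv1 hv2] := iA _ _ hv.
move/edgeP: (he) => [[er hd]|[ec hc]].
  case: (ltngtP (vcol u) (vcol v)) => lt.
  - by have := hv1 _ lt; rewrite -er => /(_ hu); lia.
  - by have := hu1 _ lt; rewrite er => /(_ hv); lia.
  - by rewrite lt subrr in hd.
case: (ltngtP (vrow u) (vrow v)) => lt.
- by have := hv2 _ lt; rewrite -ec => /(_ hu); rewrite hc.
- move/edgeP: he' => [[er _]|[_ hc']]; first by rewrite er ltnn in lt.
  by have := hu2 _ lt; rewrite ec => /(_ hv); rewrite hc'.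
- by rewrite (cell_inj _ _ ec lt) edge_irr in he.
Qed.

Lemma set_cells_indep S : independent S -> indep K omega cfl w (set_cells S).
Proof.
move=> iS; have nE u v : u \in S -> v \in S -> ~ edge u v.
  by move=> uS vS; apply/negP; move/forallP: iS => /(_ u)/implyP/(_ uS)/forallP/(_ v)/implyP/(_ vS).
move=> j i /existsP[v /andP[vS /andP[/eqP <- /eqP <-]]].
have [_ vK _] := f_cell v; split=> //; first by rewrite w_vertex weight_gt0.
- move=> j' lt /existsP[u /andP[uS /andP[/eqP ej /eqP ei]]]; subst.
  rewrite leqNgt; apply/negP => lt2; apply: (nE u v uS vS); apply/edgeP; left.
  by split=> //; lia.
- move=> i' lt /existsP[u /andP[uS /andP[/eqP ej /eqP ei]]]; subst.
  by apply/negP => h; apply: (nE u v uS vS); apply/edgeP; right.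
Qed.

(** [N] is arbitrary because the sums over blocks run past column [n]; columns beyond it contribute
    nothing. *)
Lemma wt_le_mis A N : indep K omega cfl w A -> wt K w A 1 N <= mis_weight G.
Proof.
move=> iA; have iS := indep_cell_set _ iA.
apply: (@le_trans _ _ (set_weight (cell_set A))); last exact: le_bigmax_cond.
rewrite weight_cell_set; have [le|lt] := leqP N n.+1.
  have [N0|N1] := posnP N; first by rewrite /wt N0 big_geq // wt_ge0 //; exact: w_ge0.
  by rewrite (@wt_cat _ K w A 1 N n.+1) ?N1 // lerDl; apply: wt_ge0; exact: w_ge0.
have -> : wt K w A 1 N = wt K w A 1 n.+1 + wt K w A n.+1 N by rewrite -wt_cat //= ltnW.
have -> : wt K w A n.+1 N = 0; last by rewrite addr0.
rewrite /wt big_nat_cond big1 //.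
move=> j /andP[/andP[nj _] _]; apply: big1 => i _; case: ifP => // /iA[_ /w_supp h _ _].
by move: h nj; lia.
Qed.

Lemma mis_attained : exists2 O : nat -> nat -> bool, indep K omega cfl w O &
  wt K w O 1 n.+1 = mis_weight G.
Proof.
have i0 : independent (finset.set0 : {set G}) by apply/forallP => u; rewrite inE.
have [S iS eS] : exists2 S : {set G}, independent S & mis_weight G = set_weight S.
  rewrite /mis_weight (bigmax_eq_arg 0 finset.set0) //; last first.
    by move=> S _; apply: sumr_ge0 => v _; exact/ltW/weight_gt0.
  by case: Order.TotalTheory.arg_maxP => // S iS _; exists S.
exists (set_cells S); first exact: set_cells_indep.
by rewrite -weight_cell_set set_cellsK.
Qed.

End Network.

(** * The approximation ratio and the theorem *)

(** The loss [K * cut] is at most [mu / (m + 1)], so [m * mu <= (m + 1) * tot]; and [m * eps >= 1]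
    gives [m + 1 <= (1 + eps) * m]. *)
Lemma approx_ratio (R : realType) (eps mu tot cut : R) (K m : nat) : 0 < eps -> 0 <= mu ->
  1 <= m%:R * eps -> (2 * K * m.+1)%:R * cut <= 2 * mu -> mu <= tot + K%:R * cut ->
  (1 + eps)^-1 * mu <= tot.
Proof.
move=> e0 mu0 hm hcut htot; have e1 : 0 < 1 + eps by rewrite addr_gt0.
rewrite mulrC ler_pdivrMr //.
have m1 : 0 < m.+1%:R :> R by rewrite ltr0n.
have {}hcut : m.+1%:R * (K%:R * cut) <= mu.
  rewrite -(@ler_pM2l _ 2) //; apply: le_trans hcut.
  by rewrite !natrM mulrCA !mulrA; lra.
have h1 : m%:R * mu <= m.+1%:R * tot.
  have := ler_wpM2l (ltW m1) htot; rewrite mulrDr -natr1; move: hcut; rewrite -natr1.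
  by move: (m%:R) => x; lra.
rewrite -(ler_pM2l m1); apply: (@le_trans _ _ ((1 + eps) * (m%:R * mu))).
  rewrite mulrA ler_wpM2r // -natr1; move: hm; move: (m%:R) => x; lra.
by rewrite [leRHS]mulrA [leRHS]mulrC ler_wpM2l // ltW.
Qed.

Theorem theorem3 (R : realType) (d k : nat) (hd : (0 < d)%N) (hk : (0 < k)%N) :
  exists (P : cmd) (L : R -> nat -> nat) (C : R),
  forall (eps : R), 0 < eps ->
  forall (n omega : nat), (0 < n)%N -> (0 < omega)%N ->
  forall (G : wgraph R) (f : G -> d.-tuple nat), narrow_los n k omega f ->
  exists (t : nat) (s : state R) (S : {set G}),
    [/\ exec n (L eps omega) (cell_weight f) P (init eps omega) t s,
        out s =i [seq val (f v) | v in S],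
        approx_mis eps S
      & t%:R <= C * ((1 + 1 / eps) * n%:R * k%:R ^+ (d - 1)
                  * (k%:R `^ ((d - 1)%:R / omega%:R) * omega%:R) ^+ (k ^ (d - 1)))].
Proof.
case: d hd => // l _; have -> : (l.+1 - 1 = l)%N by rewrite subn1.
pose K := (k ^ l)%N; have K_gt0 : (0 < K)%N by rewrite expn_gt0 hk.
pose cost := cost_program K (row_pt k l) (adjacent_rows k l) (row_dist k l).
(* The least [m] with [m * eps >= 1] is at most [truncn eps^-1 + 1], which bounds [2 * M * omega] by
   this look-ahead. The factor 2 in the constant comes from [m + 1 <= 2 * (1 + 1 / eps)]. *)
exists (program K (row_pt k l) (adjacent_rows k l) (row_dist k l)),
  (fun eps omega => 2 * (2 * K * (Num.truncn eps^-1).+2) * omega)%N, (cost%:R * 2).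
move=> eps e0 n omega n0 o0 G f hf.
have e0' : 0 < eps^-1 by rewrite invr_gt0.
have tr : eps^-1 < (Num.truncn eps^-1).+1%:R by rewrite truncnS_gt.
have tle : (Num.truncn eps^-1)%:R <= eps^-1 by rewrite truncn_le ltW.
have ex : exists m : nat, 1 <= m%:R * eps.
  by exists (Num.truncn eps^-1).+1; rewrite -ler_pdivrMr // div1r ltW.
case: (ex_minnP ex) => m hm hmin.
have hm_tr : (m <= (Num.truncn eps^-1).+1)%N.
  by apply: hmin; rewrite -ler_pdivrMr // div1r ltW.
have hlt j : (j < m)%N -> j%:R * eps < 1.
  by move=> jm; rewrite ltNge; apply/negP => /hmin; rewrite leqNgt jm.
have [best ibest ebest] := mis_attained l k n omega G f o0 hf.
set M := (2 * K * m.+1)%N.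
have M0 : (0 < M)%N by rewrite !muln_gt0 K_gt0.
have hL : (2 * M * omega <= 2 * (2 * K * (Num.truncn eps^-1).+2) * omega)%N.
  by rewrite leq_mul2r leq_mul2l /M leq_mul2l ltnS hm_tr !orbT.
have dgt0 i i' : adjacent_rows k l i i' -> (0 < row_dist k l i i')%N.
  by move=> /eqP h; apply: rdist_gt0; rewrite h.
have [t [s [hex ht [p np [hctx iA hpt [B [cut [_ cut0 hO hcut]]]]]]]] :=
  programP K (row_pt k l) (adjacent_rows k l) (row_dist k l) n _ (cell_weight f) omega M
    K_gt0 o0 M0 dgt0 hL (row_pt_inj k l) (w_supp l k n omega G f o0 hf) best ibest (w_ge0 l k G f)
    eps m hm hlt n0 erefl.
set A := sel K (row_pt k l) (out s) in iA.
exists t, s, (cell_set l k G f A); split=> //.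
- move=> pt; apply/idP/mapP => [pto|[v]].
    have [j [i [iK e _]]] := hpt _ pto.
    have hA : A j i by rewrite /A /sel iK -e.
    have [_ w0 _ _] := iA _ _ hA; have [v ev] := w_gt0P l k G f j i w0.
    exists v; last by rewrite ev.
    have [_ vK] := f_cell l k n omega G f o0 hf v; rewrite ev mem_enum inE => -[<- er].
    by rewrite (row_pt_inj k l (vrow l k G f v) i vK iK).
  rewrite mem_enum inE => /andP[_ h] ->.
  by have [_ _ ->] := f_cell l k n omega G f o0 hf v.
- split; first exact: (indep_cell_set l k n omega G f o0 hf).
  have htot := weight_cell_set l k n omega G f o0 hf A; rewrite htot.
  have hmu := wt_le_mis l k n omega G f o0 hf.
  apply: (approx_ratio R eps (mis_weight G) _ cut K m) => //.
  + rewrite -ebest; apply: wt_ge0; exact: w_ge0.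
  + apply: le_trans hcut _; exact: (sum_bmax _ _ _ _ o0 (w_ge0 l k G f) _ _ hmu).
  + rewrite -ebest; apply: le_trans _ hO; rewrite [leRHS](@wt_cat _ _ _ _ 1 n.+1) //.
    rewrite lerDl; apply: wt_ge0; exact: w_ge0.
have kge1 : 1 <= k%:R :> R by rewrite ler1n.
set a := k%:R `^ _.
have a1 : 1 <= a.
  by rewrite /a -[X in X <= _](powRr0 k%:R) ler_powR // divr_ge0.
(* The number of states [omega ^ K] enters the claimed bound here, through [a >= 1]. *)
have W1 : omega%:R ^+ K <= (a * omega%:R) ^+ K.
  by apply: lerXn2r; rewrite ?nnegrE ?mulr_ge0 ?(le_trans ler01 a1) // ler_peMl.
have kl1 : 1 <= k%:R ^+ l :> R by exact: exprn_ege1.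
have m2 : m.+1%:R <= 2 * (1 + 1 / eps).
  have : m.+1%:R <= (Num.truncn eps^-1).+2%:R :> R by rewrite ler_nat.
  rewrite -!natr1 div1r; move: tle e0'; lra.
apply: (@le_trans _ _ (cost * (m.+1 * n * omega ^ K))%:R); first by rewrite ler_nat.
rewrite natrM -mulrA ler_wpM2l // !natrM natrX.
apply: (@le_trans _ _ (2 * (1 + 1 / eps) * n%:R * omega%:R ^+ K)).
  by rewrite ler_wpM2r ?exprn_ge0 // ler_wpM2r.
rewrite -!mulrA ler_wpM2l // ler_wpM2l //; first by rewrite addr_ge0 // divr_ge0 // ltW.
rewrite ler_wpM2l //; apply: le_trans W1 _.
by rewrite ler_peMl // exprn_ge0 // mulr_ge0 // (le_trans ler01 a1).
Qed.
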